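(* Let $m \geq 3$ and let $M$ be a connected orientable real hypersurface in the complex two-plane Grassmannian $G_2(\mathbb{C}^{m+2})$, with shape operator $A$, Reeb vector field $\xi$, and distributions $\mathfrak{D}$, $\mathfrak{D}^\perp$ as defined in the context. If $A\mathfrak{D} \subset \mathfrak{D}$ and $\xi \in \mathfrak{D}^\perp$ at every point of $M$, then $M$ is Hopf, i.e. $\xi$ is an eigenvector of $A$ at every point of $M$.
   Context: $G_2(\mathbb{C}^{m+2})$ denotes the set of all complex 2-dimensional linear subspaces of $\mathbb{C}^{m+2}$, a compact irreducible Riemannian symmetric space. It carries a Kähler structure $J$ and a quaternionic Kähler structure $\mathfrak{J}$ not containing $J$ (identifying $T_V G_2(\mathbb{C}^{m+2})$ with $\mathrm{Hom}_{\mathbb{C}}(V,V^\perp)$, $J$ is multiplication by $i$ and $\mathfrak{J}$ is given by precomposition with elements of $\mathfrak{su}(V)$). A canonical local basis of $\mathfrak{J}$ is a local basis $\{J_1,J_2,J_3\}$ of $\mathfrak{J}$ consisting of local almost Hermitian structures with $J_aJ_{a+1}=J_{a+2}=-J_{a+1}J_a$ (indices modulo 3). One has $JJ_a=J_aJ$ and $\mathrm{Trace}(JJ_a)=0$. The Riemannian metric $g$ is normalized so that the curvature tensor is $$\bar R(X,Y)Z = g(Y,Z)X-g(X,Z)Y+g(JY,Z)JX-g(JX,Z)JY-2g(JX,Y)JZ+\sum_{a=1}^3\{g(J_aY,Z)J_aX-g(J_aX,Z)J_aY-2g(J_aX,Y)J_aZ+g(JJ_aY,Z)JJ_aX-g(JJ_aX,Z)JJ_aY\}.$$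 A real hypersurface $M$ is a (real codimension one) isometrically immersed submanifold; $N$ is a unit normal vector field on $M$ and $A$ is the shape operator, $AX=-\bar\nabla_X N$, where $\bar\nabla$ is the Levi-Civita connection of $G_2(\mathbb{C}^{m+2})$. The Reeb vector field is $\xi=-JN$. For a canonical local basis put $\xi_a=-J_aN$, $a=1,2,3$. $\mathfrak{D}^\perp=\mathrm{span}\{\xi_1,\xi_2,\xi_3\}=\mathfrak{J}N$ (independent of the choice of basis), and $\mathfrak{D}$ is the orthogonal complement of $\mathfrak{D}^\perp$ in $TM$. $M$ is called Hopf if $A\xi=\alpha\xi$ for some function $\alpha$ on $M$. *)

(* Defs.v *)
From HB Require Import structures.
From mathcomp Require Import all_boot all_order all_algebra.
From mathcomp Require Import all_classical all_reals all_analysis.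
From mathcomp Require Import sesquilinear spectral.
From mathcomp Require Import complex ring.

Set Implicit Arguments.
Unset Strict Implicit.
Unset Printing Implicit Defensive.

Import Order.TTheory GRing.Theory Num.Theory.
Import numFieldNormedType.Exports.

Local Open Scope classical_set_scope.
Local Open Scope ring_scope.
Local Open Scope sesquilinear_scope.
Local Open Scope complex_scope.

Section SmoothMaps.
Variables (R : realType) (d : nat) (W : normedModType R).
Implicit Types (U : set 'rV[R]_d) (F : 'rV[R]_d -> W).

Fixpoint Ck_on (k : nat) U F : Prop :=
  if k is k'.+1 then
    (forall x, U x -> differentiable F x) /\
    (forall v, Ck_on k' U (fun x => 'D_v F x))
  else forall x, U x -> {for x, continuous F}.

Definition smooth_on U F : Prop := forall k, Ck_on k U F.

End SmoothMaps.

Section Manifolds.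
Variables (R : realType) (d : nat).

(* [cinv] is a total function, but only its values on [cimage] matter. *)
Record chart (T : topologicalType) := Chart {
  cdom : set T;
  cmap : T -> 'rV[R]_d;
  cinv : 'rV[R]_d -> T;
  cdom_open : open cdom;
  cimage_open : open (cmap @` cdom);
  cmapK : forall p, cdom p -> cinv (cmap p) = p;
  cmap_continuous : forall p, cdom p -> {for p, continuous cmap};
  cinv_continuous : forall x, (cmap @` cdom) x -> {for x, continuous cinv} }.

Section Charts.
Variable T : topologicalType.
Implicit Types b c : chart T.

Definition cimage c : set 'rV[R]_d := cmap c @` cdom c.

Definition transition b c : 'rV[R]_d -> 'rV[R]_d := cmap c \o cinv b.

Definition overlap b c : set 'rV[R]_d := cmap b @` (cdom b `&` cdom c).

Definition smooth_compatible b c : Prop :=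
  smooth_on (overlap b c) (transition b c) /\
  smooth_on (overlap c b) (transition c b).

Definition positively_related b c : Prop :=
  forall x, overlap b c x -> 0 < \det ('J (transition b c) x).

End Charts.

(* The atlas is the family of the preferred charts [chart_at p]. *)
Record smooth_manifold := SmoothManifold {
  carrier :> topologicalType;
  carrier_hausdorff : hausdorff_space carrier;
  carrier_second_countable : @second_countable carrier;
  chart_at : carrier -> chart carrier;
  mem_chart_at : forall p, cdom (chart_at p) p;
  chart_at_compatible :
    forall p q, smooth_compatible (chart_at p) (chart_at q) }.

Definition orientable (M : smooth_manifold) : Prop :=
  exists B : set (chart M),
    [/\ forall p : M, exists2 b, B b & cdom b p,
        forall b, B b -> forall p : M, smooth_compatible b (chart_at p)
      & forall b c, B b -> B c -> positively_related b c].

End Manifolds.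

(* Maps into complex matrices are differentiated over R, through their real
   and imaginary parts. *)
Section MatrixValuedMaps.
Variables (R : realType) (d n : nat).
Local Notation Mat := 'M[R[i]]_n.

Definition mxRe (X : Mat) : 'M[R]_n := map_mx (@complex.Re R) X.
Definition mxIm (X : Mat) : 'M[R]_n := map_mx (@complex.Im R) X.

Definition smooth_mx (M : smooth_manifold R d) (F : M -> Mat) : Prop :=
  forall p : M,
    let c := chart_at p in
    smooth_on (cimage c) (mxRe \o F \o cinv c) /\
    smooth_on (cimage c) (mxIm \o F \o cinv c).

(* dF_p(v), where v is the coordinate vector of a tangent vector at p in the
   chart [chart_at p]. *)
Definition dmx (M : smooth_manifold R d) (F : M -> Mat) (p : M)
    (v : 'rV[R]_d) : Mat :=
  let c := chart_at p in
  \matrix_(i, j) ((('D_v (mxRe \o F \o cinv c) (cmap c p) : 'M[R]_n) i j)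
               +i* (('D_v (mxIm \o F \o cinv c) (cmap c p) : 'M[R]_n) i j)).

End MatrixValuedMaps.

(* A complex 2-plane V of C^n (a space of column vectors) is represented by
   the orthogonal projection P of C^n onto V, which embeds G_2(C^n) as a
   submanifold of the real vector space of Hermitian n x n matrices.  The
   tangent space at V, i.e. Hom(V, V^perp), is identified with the space of
   the endomorphisms phi of C^n with phi = (1 - P) phi P; such a phi
   corresponds to the velocity matrix [of_hom phi] = phi + phi^* of P, and is
   recovered from it by [to_hom P]. *)
Section Grassmannian.
Variables (R : realType) (n : nat).
Local Notation Mat := 'M[R[i]]_n.
Implicit Types P X Y Q : Mat.

Definition grass2 : set Mat :=
  [set P | [/\ P ^t* = P, P *m P = P & \rank P = 2%N]].

Definition to_hom P X : Mat := (1%:M - P) *m X *m P.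
Definition of_hom (phi : Mat) : Mat := phi + phi ^t*.

Definition homVVperp P : set Mat := [set phi | to_hom P phi = phi].

Definition tangentG P : set Mat := of_hom @` homVVperp P.

(* The factor 1/4 gives the normalization of the curvature tensor for which
   the maximal sectional curvature is 8. *)
Definition metric X Y : R := complex.Re (\tr (X *m Y)) / 4.

(* Orthogonal projection of a Hermitian matrix onto the tangent space at P;
   see [tproj_tangent] and [tproj_orthogonal]. *)
Definition tproj P Y : Mat := of_hom (to_hom P Y).

Definition Jstr P X : Mat := of_hom ('i *: to_hom P X).

Definition su2 P : set Mat :=
  [set Q | [/\ P *m Q *m P = Q, Q ^t* = - Q & \tr Q = 0]].

Definition qstr P Q X : Mat := of_hom (to_hom P X *m Q).

Lemma adjmxM X Y : (X *m Y) ^t* = Y ^t* *m X ^t*.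
Proof. by rewrite trmx_mul map_mxM. Qed.

Lemma adjmxK X : X ^t* ^t* = X.
Proof. by apply/matrixP => i j; rewrite !mxE conjCK. Qed.

Lemma adjmxD X Y : (X + Y) ^t* = X ^t* + Y ^t*.
Proof. by rewrite linearD map_mxD. Qed.

Lemma adjmxB X Y : (X - Y) ^t* = X ^t* - Y ^t*.
Proof. by rewrite linearB map_mxB. Qed.

Lemma adjmx1 : (1%:M : Mat) ^t* = 1%:M.
Proof. by rewrite trmx1 map_mx1. Qed.

Lemma to_hom_idem P X : grass2 P -> to_hom P (to_hom P X) = to_hom P X.
Proof.
move=> [_ PP _]; rewrite /to_hom -!mulmxA PP !mulmxA.
by congr (_ *m _ *m _); rewrite mulmxBl mul1mx mulmxBr mulmx1 PP subrr subr0.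
Qed.

Lemma of_homK P phi : grass2 P -> homVVperp P phi ->
  to_hom P (of_hom phi) = phi.
Proof.
move=> [PE PP _] /= phiE; rewrite /of_hom /to_hom mulmxDr mulmxDl.
rewrite [X in X + _]phiE -[in X in _ + X]phiE /to_hom !adjmxM adjmxB adjmx1 PE.
by rewrite !mulmxA mulmxBl mul1mx PP subrr !mul0mx addr0.
Qed.

(* The tangent space at P is the one obtained by differentiating P^* = P and
   P P = P. *)
Lemma tangentGE P X : grass2 P ->
  tangentG P X <-> X ^t* = X /\ P *m X + X *m P = X.
Proof.
move=> gP; have [PE PP _] := gP; split.
  move=> [phi phiE <-]; rewrite /of_hom adjmxD adjmxK addrC; split=> //.
  have phiP : phi *m P = phi by rewrite -phiE /to_hom -mulmxA PP.
  have Pphi : P *m phi = 0.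
    by rewrite -phiE /to_hom !mulmxA mulmxBr mulmx1 PP subrr !mul0mx.
  have Pphis : P *m phi ^t* = phi ^t* by rewrite -[in LHS]PE -adjmxM phiP.
  have phisP : phi ^t* *m P = 0.
    by rewrite -[P in LHS]PE -adjmxM Pphi trmx0 map_mx0.
  by rewrite mulmxDr mulmxDl Pphi Pphis phiP phisP addr0 add0r addrC.
move=> [XE XP]; exists (to_hom P X); first exact: to_hom_idem.
have PXP : P *m X *m P = 0.
  have /(congr1 (fun Z => P *m Z *m P)) := XP.
  rewrite mulmxDr mulmxDl !mulmxA PP -!mulmxA PP !mulmxA.
  by move/(canRL (addrK _)); rewrite subrr.
rewrite /of_hom /to_hom !adjmxM adjmxB adjmx1 PE XE.
rewrite mulmxBl mul1mx mulmxBl PXP subr0 mulmxBr mulmx1 mulmxBr !mulmxA PXP.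
by rewrite subr0 addrC.
Qed.

Lemma tproj_tangent P Y : grass2 P -> tangentG P (tproj P Y).
Proof. by move=> gP; exists (to_hom P Y) => //; exact: to_hom_idem. Qed.

Lemma tproj_orthogonal P X Y : grass2 P -> Y ^t* = Y -> tangentG P X ->
  metric X (Y - tproj P Y) = 0.
Proof.
move=> gP YE /(tangentGE _ gP)[XE XP]; have [PE PP _] := gP.
have PXP : P *m X *m P = 0.
  have /(congr1 (fun Z => P *m Z *m P)) := XP.
  rewrite mulmxDr mulmxDl !mulmxA PP -!mulmxA PP !mulmxA.
  by move/(canRL (addrK _)); rewrite subrr.
have -> : Y - tproj P Y =
    P *m Y *m P + (1%:M - P) *m Y *m (1%:M - P).
  rewrite /tproj /of_hom /to_hom !adjmxM adjmxB adjmx1 PE YE.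
  rewrite !mulmxBl !mul1mx !mulmxBr !mulmx1 ?mulmxBl !mulmxA.
  apply/matrixP => i j; rewrite !mxE; ring.
rewrite /metric.
have -> :
    \tr (X *m (P *m Y *m P + (1%:M - P) *m Y *m (1%:M - P))) = 0.
  rewrite mulmxDr linearD /= !mulmxA.
  rewrite mxtrace_mulC !mulmxA PXP mul0mx linear0 add0r.
  rewrite mxtrace_mulC !mulmxA.
  have -> : (1%:M - P) *m X *m (1%:M - P) = 0.
    rewrite mulmxBl mul1mx mulmxBr mulmx1 mulmxBl PXP subr0.
    by rewrite -addrA -opprD XP subrr.
  by rewrite mul0mx linear0.
by rewrite /= mul0r.
Qed.

End Grassmannian.

Section Hypersurfaces.
Variables (R : realType) (d n : nat) (M : smooth_manifold R d).
Local Notation Mat := 'M[R[i]]_n.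
Variables f N : M -> Mat.

Definition immersion_in_grass2 : Prop :=
  [/\ forall p, grass2 (f p), smooth_mx f & forall p, injective (dmx f p)].

(* T_pM, identified with its image under df_p. *)
Definition tangentM (p : M) : set Mat := range (dmx f p).

Definition unit_normal_field : Prop :=
  [/\ forall p, tangentG (f p) (N p),
      smooth_mx N,
      forall p, metric (N p) (N p) = 1
    & forall p X, tangentM p X -> metric (N p) X = 0].

(* A X = - nabla_X N.  The metric being a constant multiple of the one induced
   by the Euclidean space of Hermitian matrices, its Levi-Civita derivative is
   the tangential part of the ordinary derivative.  The coordinate vector of X
   is unique since f is an immersion. *)
Definition shape_operator (p : M) (X : Mat) : Mat :=
  - tproj (f p) (dmx N p (xget 0 [set v | dmx f p v = X])).

Definition reeb (p : M) : Mat := - Jstr (f p) (N p).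

Definition Dperp (p : M) : set Mat := [set qstr (f p) Q (N p) | Q in su2 (f p)].

Definition Ddist (p : M) : set Mat :=
  [set X | tangentM p X /\ forall Y, Dperp p Y -> metric X Y = 0].

Definition Hopf : Prop :=
  exists alpha : M -> R, forall p, shape_operator p (reeb p) = (alpha p)%:C *: reeb p.

End Hypersurfaces.

(* Main.v *)
(* Work in a chart and represent V by its orthogonal projection P, so that the
   normal is a Hermitian-matrix-valued map N.  As xi is in D^perp, N corresponds
   to a map of rank one v |-> w in Hom(V, V^perp), i.e. N^3 = 2 N.  Let D_- and
   D_+ be the subspaces of D of the maps killing v, respectively killing the
   complement of v in V (the eigenspaces of J J_1 on D).  Differentiating
   N^3 = 2 N and using the symmetry of A shows that A vanishes on D_-.  Since A
   preserves D^perp, testing the Codazzi equation for X in D_- and Y in D_+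
   against a field Z in D^perp gives a relation between <A Z, D^perp> and A Y.
   For Z orthogonal to xi the curvature term does not vanish for suitable X and
   Y, and this forces A Y <> 0; for Z = xi the curvature term vanishes, and with
   A Y <> 0 this forces A xi to have no component in D^perp orthogonal to xi.
   The Codazzi equation itself is used in the form of the symmetry of the second
   derivatives of P and N. *)
From HB Require Import structures.
Require Import Defs.
From mathcomp Require Import all_boot all_order all_algebra.
From mathcomp Require Import all_classical all_reals all_analysis.
From mathcomp Require Import sesquilinear.
From mathcomp Require Import complex ring lra.

Set Implicit Arguments.
Unset Strict Implicit.
Unset Printing Implicit Defensive.

Import Order.TTheory GRing.Theory Num.Theory.
Import numFieldNormedType.Exports.

Local Open Scope classical_set_scope.
Local Open Scope ring_scope.
Local Open Scope sesquilinear_scope.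
Local Open Scope complex_scope.

(** * Mixed partial derivatives *)

(** The constant in N^3 = 2 N comes from the factor 1/4 in the metric. If N = phi + phi^* is a unit
    vector, then tr(phi^* phi) = 2, so for phi of rank one phi^* phi is twice a projection. Neither
    the curvature tensor nor a connection on M is introduced: P and N are matrix-valued functions on
    an open set of R^d. The curvature term arises from the part of dN normal to the Grassmannian,
    which the derivative of P N + N P = N expresses through dP and N. The obstacle is regularity.
    For Z in D^perp, symmetry of A turns the pairing of A X with Z into one of A Z with X, and this
    identity has to be differentiated. The coordinates of Z in the frame of partial derivatives of P
    are obtained by pointwise choice. Their derivatives never occur, because the other factor, the
    component of X in D^perp, vanishes at the base point as soon as X lies in D there. Continuity of
    the coordinates along a line then suffices, and Cramer's rule provides it. *)

Section MixedPartials.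
Variables (R : realType) (V : normedModType R).
Implicit Types (g : V -> R) (x u v : V).

Lemma is_derive_line g x u (s : R) : derivable g (s *: u + x) u ->
  is_derive s 1 (fun t : R => g (t *: u + x)) ('D_u g (s *: u + x)).
Proof.
move=> dg.
have E : (fun h : R => h^-1 *: (((fun t : R => g (t *: u + x)) \o shift s) (h *: 1)
     - g (s *: u + x))) =
    (fun h => h^-1 *: ((g \o shift (s *: u + x)) (h *: u) - g (s *: u + x))).
  by apply/funext => h /=; rewrite [h *: 1]mulr1 scalerDl addrA.
by split; rewrite /derivable /derive /= E.
Qed.

(** Two applications of the mean value theorem: one in s to the increment psi between two parallel
    lines, one in r to the resulting increment of ['D_u g]. The second difference on the left is
    symmetric in u and v, which [derive_comm] exploits. *)
Lemma mixed_difference g x u v (e t : R) :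
  0 < t -> t * (`|u| + `|v|) < e ->
  (forall y, `|y - x| < e -> derivable g y u /\ derivable ('D_u g) y v) ->
  exists2 y, `|y - x| <= t * (`|u| + `|v|) &
    g (t *: u + (t *: v + x)) - g (t *: u + x) - g (t *: v + x) + g x =
      'D_v ('D_u g) y * t ^+ 2.
Proof.
move=> t0 te dg.
have bnd (s r : R) : 0 <= s <= t -> 0 <= r <= t ->
    `|s *: u + (r *: v + x) - x| <= t * (`|u| + `|v|).
  move=> /andP[s0 st] /andP[r0 rt].
  rewrite addrA addrK (le_trans (ler_normD _ _))// !normrZ mulrDr.
  by rewrite lerD// ler_wpM2r// ger0_norm.
have bnd0 (s : R) : 0 <= s <= t -> `|s *: u + x - x| <= t * (`|u| + `|v|).
  move=> s0; have := bnd s 0 s0; rewrite scale0r add0r; apply.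
  by rewrite lexx ltW.
pose psi (s : R) := g (s *: u + (t *: v + x)) - g (s *: u + x).
have dpsi (s : R) : 0 <= s <= t -> is_derive s 1 psi
    ('D_u g (s *: u + (t *: v + x)) - 'D_u g (s *: u + x)).
  move=> st; apply: is_deriveB; apply: is_derive_line.
    by apply: (dg _ _).1; apply: le_lt_trans te; apply: bnd => //; rewrite lexx ltW.
  by apply: (dg _ _).1; apply: le_lt_trans te; exact: bnd0.
have itvW (s : R) : s \in `]0, t[ -> 0 <= s <= t.
  by rewrite in_itv/= => /andP[/ltW -> /ltW ->].
have [|s st] := @MVT R psi _ 0 t t0 (fun s st => dpsi s (itvW s st)).
  apply: derivable_within_continuous => s; rewrite in_itv/= => st.
  by have [] := dpsi _ st.
have {}st := itvW _ st; rewrite subr0 => psiE.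
pose chi (r : R) := 'D_u g (r *: v + (s *: u + x)).
have dchi (r : R) : 0 <= r <= t ->
    is_derive r 1 chi ('D_v ('D_u g) (r *: v + (s *: u + x))).
  move=> rt; apply: is_derive_line.
  apply: (dg _ _).2; apply: le_lt_trans te.
  by rewrite addrCA; exact: bnd.
have [|r rt] := @MVT R chi _ 0 t t0 (fun s st => dchi s (itvW s st)).
  apply: derivable_within_continuous => r; rewrite in_itv/= => rt.
  by have [] := dchi _ rt.
have {}rt := itvW _ rt; rewrite subr0 => chiE.
exists (r *: v + (s *: u + x)); first by rewrite addrCA; exact: bnd.
have -> : g (t *: u + (t *: v + x)) - g (t *: u + x) - g (t *: v + x) + g x
    = psi t - psi 0.
  by rewrite /psi scale0r !add0r; ring.
rewrite psiE expr2 mulrA -chiE /chi scale0r add0r.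
by rewrite (addrCA (t *: v)).
Qed.

(** Schwarz's theorem. The second difference is evaluated in both orders on one parallelogram, so
    the two mixed derivatives agree at some points y1 and y2; the parallelogram is small enough for
    each to be within e / 2 of its value at x. *)
Lemma derive_comm g x u v :
  (\forall y \near x, derivable g y u) ->
  (\forall y \near x, derivable g y v) ->
  (\forall y \near x, derivable ('D_u g) y v) ->
  (\forall y \near x, derivable ('D_v g) y u) ->
  {for x, continuous ('D_v ('D_u g))} -> {for x, continuous ('D_u ('D_v g))} ->
  'D_v ('D_u g) x = 'D_u ('D_v g) x.
Proof.
move=> du dv duv dvu cuv cvu.
apply/eqP; rewrite -subr_eq0 -normr_le0; apply/ler_addgt0Pl => e e0.
rewrite addr0.
have tri (a b c : R) : `|a - c| < e / 2 -> `|b - c| < e / 2 -> `|a - b| <= e.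
  move=> h1 h2; rewrite (splitr e) (le_trans (ler_distD c _ _))//.
  by rewrite lerD// ltW// distrC.
have swap (a b c d : R) : a - b - c + d = a - c - b + d.
  by rewrite [a - b - c]addrAC.
have e2 : 0 < e / 2 by rewrite divr_gt0.
have /cvgrPdist_lt /(_ _ e2) huv := cuv; have /cvgrPdist_lt /(_ _ e2) hvu := cvu.
have : \forall y \near x, ((derivable g y u /\ derivable ('D_u g) y v) /\
   (derivable g y v /\ derivable ('D_v g) y u)) /\
   (`|'D_v ('D_u g) x - 'D_v ('D_u g) y| < e / 2 /\
    `|'D_u ('D_v g) x - 'D_u ('D_v g) y| < e / 2).
  exact: (filterI (filterI (filterI du duv) (filterI dv dvu)) (filterI huv hvu)).
move=> /nbhs_ballP[d /= d0 dP].
have {}dP y : `|y - x| < d -> _ := fun h => dP y (ltac:(by rewrite -ball_normE /= distrC)).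
(* The added 1 keeps the denominator positive when u and v are both 0. *)
pose t := d / 2 / (`|u| + `|v| + 1).
have n0 : 0 < `|u| + `|v| + 1 by rewrite ltr_wpDl// addr_ge0.
have t0 : 0 < t by rewrite !divr_gt0.
have td : t * (`|u| + `|v|) < d.
  rewrite /t mulrAC ltr_pdivrMr//.
  have : 0 <= `|u| + `|v| by rewrite addr_ge0.
  by move: (`|u| + `|v|) => a; nra.
have [y1 y1d E1] := mixed_difference t0 td (fun y yd => (dP y yd).1.1).
have td' : t * (`|v| + `|u|) < d by rewrite (addrC `|v|).
have [y2 y2d E2] := mixed_difference t0 td' (fun y yd => (dP y yd).1.2).
have /eqP : 'D_v ('D_u g) y1 * t ^+ 2 = 'D_u ('D_v g) y2 * t ^+ 2.
  by apply: etrans (esym E1) (etrans _ E2); rewrite swap addrCA.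
rewrite -subr_eq0 -mulrBl mulf_eq0 subr_eq0 expf_eq0 (gt_eqF t0)/= orbF => /eqP E.
have h1 := (dP y1 (le_lt_trans y1d td)).2.1.
have h2 := (dP y2 (le_lt_trans y2d td')).2.2.
rewrite E in h1.
exact: (tri _ _ _ h1 h2).
Qed.

End MixedPartials.

(** * Differentiation of complex matrices along real directions *)

Section ComplexParts.
Variable R : realType.
Implicit Types x y : R[i].

Lemma Re_additive : additive (@complex.Re R). Proof. by move=> [a b] [c d]. Qed.
HB.instance Definition _ :=
  GRing.isAdditive.Build R[i] R (@complex.Re R) Re_additive.

Lemma Im_additive : additive (@complex.Im R). Proof. by move=> [a b] [c d]. Qed.
HB.instance Definition _ :=
  GRing.isAdditive.Build R[i] R (@complex.Im R) Im_additive.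

Lemma complex_ReM x y : complex.Re (x * y) =
  complex.Re x * complex.Re y - complex.Im x * complex.Im y.
Proof. by case: x y => [a b] [c d]. Qed.

Lemma complex_ImM x y : complex.Im (x * y) =
  complex.Re x * complex.Im y + complex.Im x * complex.Re y.
Proof. by case: x y => [a b] [c d]. Qed.

Lemma complex_ReJ x : complex.Re (Num.conj x) = complex.Re x.
Proof. by case: x. Qed.

Lemma complex_ImJ x : complex.Im (Num.conj x) = - complex.Im x.
Proof. by case: x. Qed.

End ComplexParts.

Section ComplexMatrixDerivative.
Variables (R : realType) (V : normedModType R).

(** Differentiation over R through real and imaginary parts, as in [dmx], but entrywise and as a
    relation: derivatives of matrix expressions are built by the rules below and compared by
    [mx_is_derive_unique]. *)
Definition mx_is_derive (m n : nat) (x v : V) (F : V -> 'M[R[i]]_(m, n))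
    (F' : 'M[R[i]]_(m, n)) : Prop :=
  forall i j,
    is_derive x v (fun y => complex.Re (F y i j)) (complex.Re (F' i j)) /\
    is_derive x v (fun y => complex.Im (F y i j)) (complex.Im (F' i j)).

Section Rules.
Variables (x v : V).

Lemma mx_is_derive_eq m n (F : V -> 'M[R[i]]_(m, n)) A B :
  mx_is_derive x v F A -> A = B -> mx_is_derive x v F B.
Proof. by move=> dF <-. Qed.

Lemma mx_is_derive_unique m n (F : V -> 'M[R[i]]_(m, n)) A B :
  mx_is_derive x v F A -> mx_is_derive x v F B -> A = B.
Proof.
move=> dA dB; apply/matrixP => i j; apply/eqP; rewrite eq_complex.
have [rA iA] := dA i j; have [rB iB] := dB i j.
rewrite -(@derive_val _ _ _ _ _ _ _ rA) -(@derive_val _ _ _ _ _ _ _ iA).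
by rewrite -(@derive_val _ _ _ _ _ _ _ rB) -(@derive_val _ _ _ _ _ _ _ iB) !eqxx.
Qed.

Lemma near_mx_is_derive m n (F G : V -> 'M[R[i]]_(m, n)) A :
  (\near x, F x = G x) -> mx_is_derive x v F A -> mx_is_derive x v G A.
Proof.
move=> FG dF i j; have [rA iA] := dF i j.
by split; [apply: near_eq_is_derive rA|apply: near_eq_is_derive iA];
  apply: filterS FG => y ->.
Qed.

Lemma mx_is_derive_cst m n (A : 'M[R[i]]_(m, n)) : mx_is_derive x v (fun=> A) 0.
Proof. by move=> i j; rewrite mxE; split; exact: is_derive_cst. Qed.

Lemma mx_is_deriveD m n (F G : V -> 'M[R[i]]_(m, n)) A B :
  mx_is_derive x v F A -> mx_is_derive x v G B ->
  mx_is_derive x v (fun y => F y + G y) (A + B).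
Proof.
move=> dF dG i j; have [rF iF] := dF i j; have [rG iG] := dG i j.
by split; under eq_fun do rewrite mxE raddfD; rewrite mxE raddfD;
  exact: is_deriveD.
Qed.

Lemma mx_is_deriveN m n (F : V -> 'M[R[i]]_(m, n)) A :
  mx_is_derive x v F A -> mx_is_derive x v (fun y => - F y) (- A).
Proof.
move=> dF i j; have [rF iF] := dF i j.
by split; under eq_fun do rewrite mxE raddfN; rewrite mxE raddfN;
  exact: is_deriveN.
Qed.

Lemma mx_is_deriveB m n (F G : V -> 'M[R[i]]_(m, n)) A B :
  mx_is_derive x v F A -> mx_is_derive x v G B ->
  mx_is_derive x v (fun y => F y - G y) (A - B).
Proof. by move=> dF dG; apply: mx_is_deriveD => //; exact: mx_is_deriveN. Qed.

Lemma is_derive_sumr n (h : 'I_n -> V -> R) (h' : 'I_n -> R) :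
  (forall k, is_derive x v (h k) (h' k)) ->
  is_derive x v (fun y => \sum_k h k y) (\sum_k h' k).
Proof.
move=> dh; rewrite (_ : (fun y => _) = \sum_k h k); first exact: is_derive_sum.
by apply/funext => y; rewrite fct_sumE.
Qed.

Lemma mx_is_deriveM m n p (F : V -> 'M[R[i]]_(m, n)) (G : V -> 'M[R[i]]_(n, p)) A B :
  mx_is_derive x v F A -> mx_is_derive x v G B ->
  mx_is_derive x v (fun y => F y *m G y) (A *m G x + F x *m B).
Proof.
move=> dF dG i j.
have dM (f g : V -> R) a b : is_derive x v f a -> is_derive x v g b ->
    is_derive x v (fun y => f y * g y) (a * g x + f x * b).
  move=> df dg; apply: is_derive_eq (is_deriveM df dg) _.
  by rewrite addrC [_ *: _]mulrC.
split; under eq_fun do rewrite mxE raddf_sum; rewrite !mxE raddfD !raddf_sum/=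
  -big_split; apply: is_derive_sumr => k /=;
  have [rF iF] := dF i k; have [rG iG] := dG k j.
  under eq_fun do rewrite complex_ReM; rewrite !complex_ReM.
  apply: is_derive_eq (is_deriveB (dM _ _ _ _ rF rG) (dM _ _ _ _ iF iG)) _.
  ring.
under eq_fun do rewrite complex_ImM; rewrite !complex_ImM.
apply: is_derive_eq (is_deriveD (dM _ _ _ _ rF iG) (dM _ _ _ _ iF rG)) _.
ring.
Qed.

Lemma mx_is_derive_mulmxl m n p (A : 'M[R[i]]_(m, n)) (F : V -> 'M[R[i]]_(n, p)) B :
  mx_is_derive x v F B -> mx_is_derive x v (fun y => A *m F y) (A *m B).
Proof.
move=> dF; apply: mx_is_derive_eq (mx_is_deriveM (mx_is_derive_cst A) dF) _.
by rewrite mul0mx add0r.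
Qed.

Lemma mx_is_derive_mulmxr m n p (F : V -> 'M[R[i]]_(m, n)) (A : 'M[R[i]]_(n, p)) B :
  mx_is_derive x v F B -> mx_is_derive x v (fun y => F y *m A) (B *m A).
Proof.
move=> dF; apply: mx_is_derive_eq (mx_is_deriveM dF (mx_is_derive_cst A)) _.
by rewrite mulmx0 addr0.
Qed.

Lemma mx_is_deriveZ m n (c : R[i]) (F : V -> 'M[R[i]]_(m, n)) A :
  mx_is_derive x v F A -> mx_is_derive x v (fun y => c *: F y) (c *: A).
Proof.
move=> dF; under eq_fun do rewrite -mul_scalar_mx.
by rewrite -mul_scalar_mx; exact: mx_is_derive_mulmxl.
Qed.

Lemma mx_is_derive_adj m n (F : V -> 'M[R[i]]_(m, n)) A :
  mx_is_derive x v F A -> mx_is_derive x v (fun y => F y ^t* ) (A ^t* ).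
Proof.
move=> dF i j; have [rF iF] := dF j i; split.
  by under eq_fun do rewrite !mxE complex_ReJ; rewrite !mxE complex_ReJ.
under eq_fun do rewrite !mxE complex_ImJ; rewrite !mxE complex_ImJ.
exact: is_deriveN.
Qed.

End Rules.

End ComplexMatrixDerivative.

(** * Smooth maps into complex matrices and symmetry of their second derivatives *)

Lemma near_continuous (T S : topologicalType) (f g : T -> S) x :
  (\near x, f x = g x) -> {for x, continuous f} -> {for x, continuous g}.
Proof.
move=> fg; rewrite /prop_for /continuous_at -(nbhs_singleton fg).
by apply: cvg_trans; apply: near_eq_cvg; apply: filterS fg => y ->.
Qed.

Lemma smooth_on_differentiable (R : realType) d (W : normedModType R)
  (U : set 'rV[R]_d) (G : 'rV[R]_d -> W) x : smooth_on U G -> U x -> differentiable G x.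
Proof. by move=> /(_ 1%N)[+ _]; apply. Qed.

Section SmoothMatrixMaps.
Variables (R : realType) (d n : nat).
Local Notation V := 'rV[R]_d.
Local Notation Mat := 'M[R[i]]_n.
Implicit Types (U : set V) (x u v : V).

Section RealMatrices.
Implicit Type G : V -> 'M[R]_n.

Lemma smooth_on_derive U G v : smooth_on U G -> smooth_on U (fun x => 'D_v G x).
Proof. by move=> sG k; have [_] := sG k.+1; apply. Qed.

Lemma derivable_entry G x v i j : derivable G x v ->
  is_derive x v (fun y => G y i j) ('D_v G x i j).
Proof.
move=> dG; split; first exact: (derivable_mxP _ _ _).1.
by rewrite derive_mx// mxE.
Qed.

Lemma continuous_entry G x i j : {for x, continuous G} ->
  {for x, continuous (fun y => G y i j)}.
Proof. move=> cG; apply: (@continuous_comp _ _ _ G (fun A : 'M[R]_n => A i j)) => //.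
exact: coord_continuous. Qed.

Lemma derive_lincomb G x (I : finType) (a : I -> R) (w : I -> V) :
  differentiable G x ->
  'D_(\sum_k a k *: w k) G x = \sum_k a k *: 'D_(w k) G x.
Proof.
move=> dG; rewrite deriveE// linear_sum; apply: eq_bigr => k _.
by rewrite linearZ deriveE.
Qed.

Lemma smooth_derive_comm U G x u v : open U -> smooth_on U G -> U x ->
  'D_u (fun y => 'D_v G y) x = 'D_v (fun y => 'D_u G y) x.
Proof.
move=> oU sG Ux.
have d0 y w : U y -> derivable G y w.
  by move=> Uy; apply: diff_derivable; exact: smooth_on_differentiable sG Uy.
have d1 y w w' : U y -> derivable (fun y => 'D_w G y) y w'.
  move=> Uy; apply: diff_derivable; apply: smooth_on_differentiable Uy.
  exact: smooth_on_derive.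
have c2 w w' : {for x, continuous (fun y => 'D_w' (fun y => 'D_w G y) y)}.
  apply: differentiable_continuous; apply: smooth_on_differentiable Ux.
  by do 2!apply: smooth_on_derive.
have nU (P : V -> Prop) : (forall y, U y -> P y) -> \forall y \near x, P y.
  by move=> UP; apply: filterS (open_nbhs_nbhs (conj oU Ux)).
have e1 y i j w : U y -> 'D_w (fun z => G z i j) y = 'D_w G y i j.
  by move=> Uy; apply: derive_val; exact: derivable_entry (d0 _ _ Uy).
have e2 y i j w w' : U y ->
    'D_w' ('D_w (fun z => G z i j)) y = 'D_w' (fun z => 'D_w G z) y i j.
  move=> Uy; rewrite -(@derive_val _ _ _ _ _ _ _ (derivable_entry i j (d1 _ w w' Uy))).
  apply: near_eq_derive; apply: filterS (open_nbhs_nbhs (conj oU Uy)) => z Uz.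
  exact: e1.
apply/matrixP => i j; apply: etrans (esym (e2 x i j v u Ux)) _.
apply: etrans (e2 x i j u v Ux); apply: derive_comm.
- by apply: nU => y Uy; have [] := derivable_entry i j (d0 y v Uy).
- by apply: nU => y Uy; have [] := derivable_entry i j (d0 y u Uy).
- apply: nU => y Uy; have [+ _] := derivable_entry i j (d1 y v u Uy).
  apply: near_eq_derivable; apply: filterS (open_nbhs_nbhs (conj oU Uy)) => z Uz.
  by rewrite e1.
- apply: nU => y Uy; have [+ _] := derivable_entry i j (d1 y u v Uy).
  apply: near_eq_derivable; apply: filterS (open_nbhs_nbhs (conj oU Uy)) => z Uz.
  by rewrite e1.
- apply: near_continuous (continuous_entry (c2 v u)); apply: nU => y Uy.
  exact/esym/e2.
- apply: near_continuous (continuous_entry (c2 u v)); apply: nU => y Uy.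
  exact/esym/e2.
Qed.

End RealMatrices.

Implicit Type F : V -> Mat.

Definition complex_mx (A B : 'M[R]_n) : Mat := \matrix_(i, j) (A i j +i* B i j).

Lemma complex_mx_lincomb (I : finType) (a : I -> R) (A B : I -> 'M[R]_n) :
  complex_mx (\sum_k a k *: A k) (\sum_k a k *: B k) =
  \sum_k (a k)%:C *: complex_mx (A k) (B k).
Proof.
apply/matrixP => i j; rewrite mxE !summxE; apply/eqP; rewrite eq_complex /=.
rewrite !raddf_sum /=; apply/andP; split; apply/eqP; apply: eq_bigr => k _;
  by rewrite !mxE /= mul0r ?subr0 ?addr0.
Qed.

(** The body repeats that of [dmx], so that [dmxE] holds by conversion, while here the base point
    may range over a whole chart image. *)
Definition cderive v F x : Mat :=
  complex_mx ('D_v (@mxRe R n \o F) x) ('D_v (@mxIm R n \o F) x).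

Definition csmooth_on U F : Prop :=
  smooth_on U (@mxRe R n \o F) /\ smooth_on U (@mxIm R n \o F).

Lemma mxRe_entry F i j :
  (fun x => (@mxRe R n \o F) x i j) = fun x => complex.Re (F x i j).
Proof. by apply/funext => x; rewrite mxE. Qed.

Lemma mxIm_entry F i j :
  (fun x => (@mxIm R n \o F) x i j) = fun x => complex.Im (F x i j).
Proof. by apply/funext => x; rewrite mxE. Qed.

Lemma mxRe_cderive v F : @mxRe R n \o cderive v F = fun x => 'D_v (@mxRe R n \o F) x.
Proof. by apply/funext => x; apply/matrixP => i j; rewrite !mxE. Qed.

Lemma mxIm_cderive v F : @mxIm R n \o cderive v F = fun x => 'D_v (@mxIm R n \o F) x.
Proof. by apply/funext => x; apply/matrixP => i j; rewrite !mxE. Qed.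

Lemma csmooth_on_derive U F v : csmooth_on U F -> csmooth_on U (cderive v F).
Proof.
move=> [rF iF]; split.
  by rewrite mxRe_cderive; exact: smooth_on_derive.
by rewrite mxIm_cderive; exact: smooth_on_derive.
Qed.

Lemma csmooth_is_derive U F x v : csmooth_on U F -> U x ->
  mx_is_derive x v F (cderive v F x).
Proof.
move=> [rF iF] Ux i j; rewrite mxE /=.
have dr : derivable (@mxRe R n \o F) x v.
  exact/diff_derivable/(smooth_on_differentiable rF).
have di : derivable (@mxIm R n \o F) x v.
  exact/diff_derivable/(smooth_on_differentiable iF).
have := derivable_entry i j dr; have := derivable_entry i j di.
by rewrite (mxRe_entry F i j) (mxIm_entry F i j).
Qed.

Lemma cderive_comm U F x u v : open U -> csmooth_on U F -> U x ->
  cderive u (cderive v F) x = cderive v (cderive u F) x.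
Proof.
move=> oU [rF iF] Ux; apply: (congr2 complex_mx).
  apply: etrans (congr1 (fun G => 'D_u G x) (mxRe_cderive v F)) _.
  apply: etrans (smooth_derive_comm u v oU rF Ux) _.
  exact: esym (congr1 (fun G => 'D_v G x) (mxRe_cderive u F)).
apply: etrans (congr1 (fun G => 'D_u G x) (mxIm_cderive v F)) _.
apply: etrans (smooth_derive_comm u v oU iF Ux) _.
exact: esym (congr1 (fun G => 'D_v G x) (mxIm_cderive u F)).
Qed.

Lemma cderive_lincomb U F x (I : finType) (a : I -> R) (w : I -> V) :
  csmooth_on U F -> U x ->
  cderive (\sum_k a k *: w k) F x = \sum_k (a k)%:C *: cderive (w k) F x.
Proof.
move=> [rF iF] Ux; rewrite -complex_mx_lincomb; apply: (congr2 complex_mx).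
  exact/derive_lincomb/(smooth_on_differentiable rF).
exact/derive_lincomb/(smooth_on_differentiable iF).
Qed.

End SmoothMatrixMaps.

(** * Limits of solutions of linear systems *)

Section LinearSystems.
Variables (R : realType) (T : Type) (F : set_system T).
Context {FF : ProperFilter F}.

Lemma cvg_bigsum (I : Type) (r : seq I) (f : I -> T -> R) (l : I -> R) :
  (forall i, f i t @[t --> F] --> l i) ->
  \sum_(i <- r) f i t @[t --> F] --> \sum_(i <- r) l i.
Proof.
move=> fl; elim: r => [|i r IHr].
  by under eq_fun do rewrite big_nil; rewrite big_nil; exact: cvg_cst.
by under eq_fun do rewrite big_cons; rewrite big_cons; exact: cvgD.
Qed.

Lemma cvg_bigprod (I : Type) (r : seq I) (f : I -> T -> R) (l : I -> R) :
  (forall i, f i t @[t --> F] --> l i) ->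
  \prod_(i <- r) f i t @[t --> F] --> \prod_(i <- r) l i.
Proof.
move=> fl; elim: r => [|i r IHr].
  by under eq_fun do rewrite big_nil; rewrite big_nil; exact: cvg_cst.
by under eq_fun do rewrite big_cons; rewrite big_cons; exact: cvgM.
Qed.

Lemma cvg_det d (A : T -> 'M[R]_d) (A0 : 'M[R]_d) :
  (forall i j, A t i j @[t --> F] --> A0 i j) ->
  \det (A t) @[t --> F] --> \det A0.
Proof.
move=> cA; rewrite /determinant; apply: cvg_bigsum => s.
by apply: cvgM; [exact: cvg_cst|exact: cvg_bigprod].
Qed.

Lemma cvg_adjugate d (A : T -> 'M[R]_d) (A0 : 'M[R]_d) :
  (forall i j, A t i j @[t --> F] --> A0 i j) ->
  forall i j, (\adj (A t)) i j @[t --> F] --> (\adj A0) i j.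
Proof.
move=> cA i j; rewrite mxE; under eq_fun do rewrite mxE.
rewrite /cofactor; apply: cvgM; first exact: cvg_cst.
by apply: cvg_det => k l; rewrite !mxE; under eq_fun do rewrite !mxE; exact: cA.
Qed.

(** Cramer's formula expresses z t continuously through A t and y t wherever the determinant of A t
    is nonzero, hence near the limit. Nothing is assumed of z besides the equation. *)
Lemma linear_system_cvg d (A : T -> 'M[R]_d) (A0 : 'M[R]_d)
    (y z : T -> 'rV[R]_d) (z0 : 'rV[R]_d) :
  (forall i j, A t i j @[t --> F] --> A0 i j) -> A0 \in unitmx ->
  (forall j, y t 0 j @[t --> F] --> (z0 *m A0) 0 j) ->
  (\forall t \near F, z t *m A t = y t) ->
  forall i, z t 0 i @[t --> F] --> z0 0 i.
Proof.
move=> cA uA cy zE i.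
have dA0 : \det A0 != 0 by rewrite -unitfE.
have cramer (B : 'M[R]_d) (w : 'rV[R]_d) : \det B != 0 ->
    w 0 i = (\det B)^-1 * \sum_j (w *m B) 0 j * (\adj B) j i.
  move=> dB; have := congr1 (fun M : 'rV[R]_d => M 0 i) (mulmxA w B (\adj B)).
  by rewrite mul_mx_adj mul_mx_scalar !mxE => <-; rewrite mulKf.
rewrite (cramer _ _ dA0).
have nz : \forall t \near F, \det (A t) != 0.
  exact: (cvgr_neq0 _ (cvg_det cA) dA0).
apply: cvg_trans (_ : (fun t => (\det (A t))^-1 *
    \sum_j y t 0 j * (\adj (A t)) j i) @ F --> _).
  apply: near_eq_cvg; apply: filterS2 zE nz => t ztE dt.
  by rewrite (cramer _ _ dt) ztE.
apply: cvgM; first by apply: cvgV => //; exact: cvg_det.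
by apply: cvg_bigsum => j; apply: cvgM => //; exact: cvg_adjugate.
Qed.

End LinearSystems.

(** * Limits and products along a line *)

Section LineLimits.
Variables (R : realType) (V : normedModType R).
Implicit Types (x u : V) (f g : V -> R).

(** The increment of f is h times a convergent difference quotient. Only values on one line are
    controlled, which is what [is_deriveM_vanishing] asks for. *)
Lemma is_derive_cvg x u f df : is_derive x u f df ->
  f (h *: u + x) @[h --> 0^'] --> f x.
Proof.
move=> [df0 _].
have E : (fun h : R => f (h *: u + x)) =
    (fun h => f x + h * (h^-1 *: ((f \o shift x) (h *: u) - f x))).
  apply/funext => h /=; have [->|h0] := eqVneq h 0.
    by rewrite mul0r addr0 scale0r add0r.
  have -> := mulVKf h0 (f (h *: u + x) - f x).
  by rewrite [RHS]addrC subrK.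
rewrite E -[X in _ --> X]addr0 -[X in _ + X](mul0r ('D_u f x)).
apply: cvgD; first exact: cvg_cst.
by apply: cvgM => //; apply: cvg_within.
Qed.

(* The factor [f] need not be differentiable, since [g] vanishes at [x]. *)
Lemma is_deriveM_vanishing x u f g dg :
  f (h *: u + x) @[h --> 0^'] --> f x -> g x = 0 ->
  is_derive x u g dg -> is_derive x u (fun y => f y * g y) (f x * dg).
Proof.
move=> cf gx [dg0 <-].
have E : (fun h : R => h^-1 *: (((fun y => f y * g y) \o shift x) (h *: u)
      - f x * g x)) =
    (fun h => f (h *: u + x) * (h^-1 *: ((g \o shift x) (h *: u) - g x))).
  by apply/funext => h /=; rewrite gx mulr0 !subr0 [LHS]mulrCA.
have lim : (fun h : R => h^-1 *: (((fun y => f y * g y) \o shift x) (h *: u)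
      - f x * g x)) @ 0^' --> f x * 'D_u g x.
  by rewrite E; exact: cvgM.
by split; [apply/cvg_ex; exists (f x * 'D_u g x)|apply/cvg_lim].
Qed.

End LineLimits.

(** * Hermitian matrices and normals of rank one *)

Section MatrixAlgebra.
Variables (R : realType) (n : nat).
Local Notation C := R[i].
Local Notation Mat := 'M[C]_n.
Implicit Types A B P N K X Y Q : Mat.

Lemma adjmxN A : (- A) ^t* = - A ^t*.
Proof. by rewrite linearN map_mxN. Qed.

Lemma adjmxZ (k : C) A : (k *: A) ^t* = Num.conj k *: A ^t*.
Proof. by rewrite linearZ map_mxZ. Qed.

Lemma mxtrace_adj A : \tr (A ^t* ) = Num.conj (\tr A).
Proof. by rewrite /mxtrace rmorph_sum; apply: eq_bigr => i _; rewrite !mxE. Qed.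

Lemma Re_mxtrace_mul_adj A : complex.Re (\tr (A *m A ^t* )) =
  \sum_i \sum_j (complex.Re (A i j) ^+ 2 + complex.Im (A i j) ^+ 2).
Proof.
rewrite /mxtrace raddf_sum; apply: eq_bigr => i _; rewrite mxE raddf_sum.
apply: eq_bigr => j _; rewrite !mxE /= complex_ReM complex_ReJ complex_ImJ.
by rewrite mulrN opprK !expr2.
Qed.

Lemma Re_mxtrace_mul_adj_eq0 A : complex.Re (\tr (A *m A ^t* )) = 0 -> A = 0.
Proof.
rewrite Re_mxtrace_mul_adj => /eqP.
have ge0 i j : 0 <= complex.Re (A i j) ^+ 2 + complex.Im (A i j) ^+ 2.
  by rewrite addr_ge0// sqr_ge0.
rewrite psumr_eq0 => [/allP A0|i _]; last exact: sumr_ge0.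
apply/matrixP => i j; rewrite mxE.
have := A0 i (mem_index_enum i); rewrite psumr_eq0// => /allP/(_ j).
rewrite mem_index_enum => /(_ isT) /=.
rewrite paddr_eq0 ?sqr_ge0// !sqrf_eq0 => /andP[re im].
by apply/eqP; rewrite eq_complex re im.
Qed.

Lemma mulmx_adj_eq0 A : A *m A ^t* = 0 -> A = 0.
Proof. by move=> A0; apply: Re_mxtrace_mul_adj_eq0; rewrite A0 mxtrace0. Qed.

Lemma Re_mxtrace_nondegenerate A :
  (forall K, complex.Re (\tr (A *m K)) = 0) -> A = 0.
Proof. by move=> A0; apply: Re_mxtrace_mul_adj_eq0. Qed.

Lemma metricC X Y : metric X Y = metric Y X.
Proof. by rewrite /metric mxtrace_mulC. Qed.

Lemma metricDr X Y Z : metric X (Y + Z) = metric X Y + metric X Z.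
Proof. by rewrite /metric mulmxDr linearD raddfD mulrDl. Qed.

Lemma metricNr X Y : metric X (- Y) = - metric X Y.
Proof. by rewrite /metric mulmxN linearN raddfN mulNr. Qed.

Lemma metricBr X Y Z : metric X (Y - Z) = metric X Y - metric X Z.
Proof. by rewrite metricDr metricNr. Qed.

Lemma metricDl X Y Z : metric (X + Y) Z = metric X Z + metric Y Z.
Proof. by rewrite metricC metricDr !(metricC Z). Qed.

Lemma metricZr (k : R) X Y : metric X (k%:C *: Y) = k * metric X Y.
Proof. by rewrite /metric -scalemxAr linearZ /= complex_ReM /= mul0r subr0 mulrA. Qed.

Lemma metric_of_hom X K : X ^t* = X ->
  metric X (of_hom K) = complex.Re (\tr (X *m K)) / 2.
Proof.
move=> XE; rewrite /metric mulmxDr linearD raddfD /=.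
have -> : \tr (X *m K ^t* ) = Num.conj (\tr (X *m K)).
  by rewrite -[in LHS]XE -adjmxM mxtrace_adj mxtrace_mulC.
by rewrite complex_ReJ; field.
Qed.

(** In the rank factorization P = B D, cancelling B on the left and D on the right of P P = P leaves
    D B = 1. The matrix D K B is then the compression of K to the image of P. *)
Lemma idempotent_factor P : P *m P = P ->
  exists (B : 'M[C]_(n, \rank P)) (D : 'M[C]_(\rank P, n)),
    P = B *m D /\ D *m B = 1%:M.
Proof.
move=> PP; exists (col_base P), (row_base P); split; first by rewrite mulmx_base.
have /row_fullP[B' B'E] := col_base_full P.
have /row_freeP[D' D'E] := row_base_free P.
move: (mulmx_base P) B'E D'E; move: (col_base P) (row_base P) => B D BD B'E D'E.
have : B' *m (B *m D *m (B *m D)) *m D' = B' *m (B *m D) *m D'.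
  by rewrite BD PP.
by rewrite !mulmxA B'E mul1mx -[X in X = _]mulmxA D'E mulmx1 => ->.
Qed.

Lemma mxtrace_idempotent P : P *m P = P -> \tr P = (\rank P)%:R.
Proof.
move=> /idempotent_factor[B [D [PE DB]]].
by rewrite [X in \tr X]PE mxtrace_mulC DB mxtrace1.
Qed.

(** The compression D K B of K is a 1 x 1 matrix, hence the scalar given by its trace. *)
Lemma rank1_idempotent P K : P *m P = P -> \tr P = 1 ->
  P *m K *m P = \tr (K *m P) *: P.
Proof.
move=> PP; rewrite mxtrace_idempotent// => /eqP; rewrite pnatr_eq1 => /eqP.
have [B [D []]] := idempotent_factor PP.
move: (\rank P) B D => r B D PE DB r1; subst r; rewrite PE.
have -> : B *m D *m K *m (B *m D) = B *m (D *m K *m B) *m D by rewrite !mulmxA.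
rewrite [D *m K *m B]mx11_scalar mul_mx_scalar -scalemxAl; congr (_ *: _).
by rewrite mulmxA mxtrace_mulC mulmxA /mxtrace big_ord1.
Qed.

End MatrixAlgebra.

Section Det2.
Variable F : fieldType.
Implicit Type A : 'M[F]_2.

Lemma det_mx22 A :
  \det A = A ord0 ord0 * A ord_max ord_max - A ord0 ord_max * A ord_max ord0.
Proof.
rewrite (expand_det_row _ ord0) !big_ord_recl big_ord0 addr0 /cofactor !det_mx11.
rewrite !mxE /= expr0 mul1r expr1 mulN1r mulrN.
by congr (A _ _ * A _ _ - A _ _ * A _ _); exact: val_inj.
Qed.

(** The Cayley-Hamilton identity for a singular 2 x 2 matrix. *)
Lemma sqr_mx22 A : \det A = 0 -> A *m A = \tr A *: A.
Proof.
rewrite det_mx22 => /eqP; rewrite subr_eq0 => /eqP dA.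
have trE : \tr A = A ord0 ord0 + A ord_max ord_max.
  rewrite /mxtrace !big_ord_recl big_ord0 addr0; congr (_ + A _ _); exact: val_inj.
have lE : lift ord0 ord0 = ord_max :> 'I_2 by exact: val_inj.
apply/matrixP => i j; rewrite !mxE trE !big_ord_recl big_ord0 addr0 lE.
have ordE (k : 'I_2) : k = ord0 \/ k = ord_max.
  by case: k => -[|[|//]] h; [left|right]; exact: val_inj.
case: (ordE i) => ->; case: (ordE j) => ->; ring: dA.
Qed.

End Det2.

(** * Normals of rank one *)

Section RankOne.
Variables (R : realType) (n : nat).
Local Notation C := R[i].
Local Notation Mat := 'M[C]_n.
Implicit Types A B P N K X Y Q : Mat.

Lemma hom_adj_l P phi : grass2 P -> homVVperp P phi -> P *m phi = 0.
Proof.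
move=> [_ PP _] /= <-.
by rewrite /to_hom !mulmxA mulmxBr mulmx1 PP subrr !mul0mx.
Qed.

Lemma hom_adj_r P phi : grass2 P -> homVVperp P phi -> phi *m P = phi.
Proof. by move=> [_ PP _] /= phiE; rewrite -{1}phiE /to_hom -mulmxA PP. Qed.

Lemma to_homN P N : grass2 P -> tangentG P N -> to_hom P N = N *m P.
Proof.
move=> gP tN; have [_ PN] := (tangentGE _ gP).1 tN; have [_ PP _] := gP.
have PNP : P *m N *m P = 0.
  have /(congr1 (fun Z => P *m Z *m P)) := PN.
  rewrite mulmxDr mulmxDl !mulmxA PP -!mulmxA PP !mulmxA.
  by move/(canRL (addrK _)); rewrite subrr.
by rewrite /to_hom mulmxBl mul1mx mulmxBl PNP subr0.
Qed.

(** For the map v in Hom(V, V^perp) attached to N, the hypothesis on Q reads v Q = - i v, hence M Q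
    = - i M with M = v^* v. If M were invertible on V, Q would be - i there and have trace - 2 i. So
    M is singular on V, and its trace 2 makes M / 2 a projection. *)
Lemma rank_one_of_eigen P N Q : grass2 P -> tangentG P N -> metric N N = 1 ->
  su2 P Q -> qstr P Q N = - Jstr P N -> N *m N *m N = 2%:R *: N.
Proof.
move=> gP tN NN [QP QE Q0] QN; have [PE PP rP] := gP.
have [NE _] := (tangentGE _ gP).1 tN.
have QPr : Q *m P = Q by rewrite -QP -!mulmxA PP.
have QPl : P *m Q = Q by rewrite -QP !mulmxA PP.
pose v := to_hom P N.
have vE : homVVperp P v by exact: to_hom_idem.
have Pv := hom_adj_l gP vE; have vP := hom_adj_r gP vE.
have NvE : N = of_hom v.
  by case: tN => w /= wE wN; rewrite /v -wN of_homK.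
have hQ (K : Mat) : K *m P = K -> homVVperp P (v *m K).
  move=> KP; rewrite /homVVperp /= /to_hom -(mulmxA _ _ P) -(mulmxA v) KP.
  by rewrite mulmxA mulmxBl mul1mx Pv subr0.
have vQ : v *m Q = - ('i *: v).
  have iv : homVVperp P (- ('i *: v)).
    have -> : - ('i *: v) = v *m (- 'i *: P) by rewrite -scalemxAr vP scaleNr.
    by apply: hQ; rewrite -scalemxAl PP.
  have := congr1 (to_hom P) QN.
  rewrite /qstr -/v of_homK//; last exact: hQ.
  have -> : - Jstr P N = of_hom (- ('i *: v)).
    by rewrite /Jstr -/v /of_hom adjmxN opprD.
  by rewrite of_homK.
clearbody v.
pose M := v ^t* *m v.
have Pva : v ^t* *m P = 0 by rewrite -[P in LHS]PE -adjmxM Pv trmx0 map_mx0.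
have vaP : P *m v ^t* = v ^t* by rewrite -[in LHS]PE -adjmxM vP.
have vv0 : v *m v = 0 by rewrite -{1}vP -mulmxA Pv mulmx0.
have vava0 : v ^t* *m v ^t* = 0 by rewrite -adjmxM vv0 trmx0 map_mx0.
have MP : M *m P = M by rewrite /M -mulmxA vP.
have PM : P *m M = M by rewrite /M mulmxA vaP.
have ME : M ^t* = M by rewrite /M adjmxM adjmxK.
have MQ : M *m Q = - ('i *: M) by rewrite /M -mulmxA vQ mulmxN -scalemxAr.
have trM : \tr M = 2.
  have re : complex.Re (\tr M) = 2.
    have := NN; rewrite /metric NvE /of_hom mulmxDl !mulmxDr vv0 vava0 addr0 add0r.
    by rewrite linearD /= mxtrace_mulC -/M raddfD /= => ?; lra.
  have im : complex.Im (\tr M) = 0.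
    by have := congr1 (@complex.Im R) (mxtrace_adj M); rewrite ME complex_ImJ => ?; lra.
  by rewrite -(rmorph_nat (real_complex R)) /= -re; case: (\tr M) im => a b /= ->.
have := idempotent_factor PP; rewrite rP => -[B [D [PBD DB]]].
(* Compressing to V gives 2 x 2 matrices, for which the determinant is meaningful. *)
pose mm := D *m M *m B; pose q := D *m Q *m B.
have mq : mm *m q = - ('i *: mm).
  rewrite /mm /q -[RHS]scaleNr.
  have -> : D *m M *m B *m (D *m Q *m B) = D *m (M *m (B *m D) *m Q) *m B.
    by rewrite !mulmxA.
  by rewrite -PBD MP MQ -scaleNr -scalemxAr -scalemxAl.
have trq : \tr q = 0 by rewrite /q mxtrace_mulC mulmxA -PBD QPl.
have trm : \tr mm = 2 by rewrite /mm mxtrace_mulC mulmxA -PBD PM.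
have dm : \det mm = 0.
  apply: contra_eq trq; rewrite -unitfE -[_ \is a _]/(mm \in unitmx) => mU.
  have -> : q = - ('i *: 1%:M).
    by rewrite -(mulKmx mU q) mq mulmxN -scalemxAr mulVmx.
  rewrite linearN linearZ /= mxtrace1 oppr_eq0 mulf_eq0 pnatr_eq0 orbF.
  by rewrite eq_complex /= oner_eq0 andbF.
have MM : M *m M = 2 *: M.
  have ME' : M = B *m mm *m D.
    have -> : B *m mm *m D = B *m D *m M *m (B *m D) by rewrite /mm !mulmxA.
    by rewrite -PBD PM MP.
  rewrite {1 2}ME'.
  have -> : B *m mm *m D *m (B *m mm *m D) = B *m (mm *m (D *m B) *m mm) *m D.
    by rewrite !mulmxA.
  by rewrite DB mulmx1 (sqr_mx22 dm) trm -scalemxAr -scalemxAl -ME'.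
have vM : v *m M = 2 *: v.
  apply/eqP; rewrite -subr_eq0; apply/eqP.
  (* By M M = 2 M, each of the four terms of the expansion is 4 M up to sign. *)
  have vMv : (v *m M - 2 *: v) ^t* *m (v *m M - 2 *: v) = 0.
    rewrite adjmxB adjmxM ME adjmxZ conjC_nat mulmxBl !mulmxBr.
    have -> : M *m v ^t* *m (v *m M) = 4 *: M.
      by rewrite mulmxA -(mulmxA M) -/M MM -scalemxAl MM scalerA -natrM.
    have -> : M *m v ^t* *m (2 *: v) = 4 *: M.
      by rewrite -scalemxAr -mulmxA -/M MM scalerA -natrM.
    have -> : 2 *: v ^t* *m (v *m M) = 4 *: M.
      by rewrite -scalemxAl mulmxA -/M MM scalerA -natrM.
    have -> : 2 *: v ^t* *m (2 *: v) = 4 *: M.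
      by rewrite -scalemxAl -scalemxAr -/M scalerA -natrM.
    by rewrite subrr.
  have := @mulmx_adj_eq0 R n ((v *m M - 2 *: v) ^t* ).
  rewrite adjmxK => /(_ vMv)/(congr1 (fun A => A ^t* )).
  by rewrite adjmxK trmx0 map_mx0.
have vvv : v *m v ^t* *m v = 2 *: v by rewrite -mulmxA.
have vvva : v ^t* *m v *m v ^t* = 2 *: v ^t*.
  by have := congr1 (fun A => A ^t* ) vvv; rewrite /= !adjmxM adjmxZ conjC_nat adjmxK mulmxA.
have NNE : N *m N = v *m v ^t* + v ^t* *m v.
  by rewrite NvE /of_hom mulmxDl !mulmxDr vv0 vava0 add0r addr0.
rewrite NNE NvE /of_hom mulmxDl !mulmxDr vvv vvva.
by rewrite -!mulmxA vv0 vava0 !mulmx0 addr0 add0r scalerDr.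
Qed.

End RankOne.

(* If N corresponds to sqrt 2 times the rank one map v |-> w of V into V^perp,
   where v and w are unit vectors, these are the orthogonal projections onto
   the line of v, its complement in V, the line of w, and its complement in
   V^perp.  They are locked to keep unification from unfolding them. *)
HB.lock Definition src (R : realType) (n : nat) (P N : 'M[R[i]]_n) : 'M[R[i]]_n :=
  2%:R^-1 *: (P *m N *m N).
HB.lock Definition src_compl (R : realType) (n : nat) (P N : 'M[R[i]]_n) :
  'M[R[i]]_n := P - src P N.
HB.lock Definition tgt (R : realType) (n : nat) (P N : 'M[R[i]]_n) : 'M[R[i]]_n :=
  2%:R^-1 *: (N *m P *m N).
HB.lock Definition tgt_compl (R : realType) (n : nat) (P N : 'M[R[i]]_n) :
  'M[R[i]]_n := 1%:M - P - tgt P N.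

(** * The four projections attached to a normal of rank one *)

Section NormalProjections.
Variables (R : realType) (n : nat).
Local Notation C := R[i].
Local Notation Mat := 'M[C]_n.
Implicit Types P N K L X Y Z W Q B : Mat.

Definition rank1_normal P N : Prop :=
  [/\ grass2 P, tangentG P N, metric N N = 1 & N *m N *m N = 2%:R *: N].

Lemma srcE P N : src P N = 2%:R^-1 *: (P *m N *m N).
Proof. by rewrite unlock. Qed.

Lemma src_complE P N : src_compl P N = P - src P N.
Proof. by rewrite src_compl.unlock. Qed.

Lemma tgtE P N : tgt P N = 2%:R^-1 *: (N *m P *m N).
Proof. by rewrite unlock. Qed.

Lemma tgt_complE P N : tgt_compl P N = 1%:M - P - tgt P N.
Proof. by rewrite tgt_compl.unlock. Qed.

Section Identities.
Variables P N : Mat.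
Hypothesis PN1 : rank1_normal P N.
Local Notation a := (src P N).
Local Notation c := (src_compl P N).
Local Notation b := (tgt P N).
Local Notation e := (tgt_compl P N).

Let gP : grass2 P. Proof. by case: PN1. Qed.
Let tN : tangentG P N. Proof. by case: PN1. Qed.
Let PE : P ^t* = P. Proof. by case: gP. Qed.
Let PP : P *m P = P. Proof. by case: gP. Qed.
Let NE : N ^t* = N. Proof. by case: ((tangentGE N gP).1 tN). Qed.
Let PNNP : P *m N + N *m P = N. Proof. by case: ((tangentGE N gP).1 tN). Qed.
Let NNN : N *m N *m N = 2%:R *: N. Proof. by case: PN1. Qed.
Let two_neq0 : (2%:R : C) != 0. Proof. by rewrite pnatr_eq0. Qed.

Lemma tangent_sandwich X : P *m X + X *m P = X -> P *m X *m P = 0.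
Proof.
move/(congr1 (fun Z => P *m Z *m P)).
rewrite mulmxDr mulmxDl !mulmxA PP -!mulmxA PP !mulmxA.
by move/(canRL (addrK _)); rewrite subrr.
Qed.

Lemma PNP0 : P *m N *m P = 0. Proof. exact: tangent_sandwich. Qed.

Lemma mulNP : N *m P = N - P *m N.
Proof. by rewrite -[X in X - _]PNNP addrAC subrr add0r. Qed.

Lemma NPN_NN : N *m P *m N = N *m N - P *m N *m N.
Proof. by rewrite mulNP mulmxBl. Qed.

Lemma NNP_PNN : N *m N *m P = P *m N *m N.
Proof.
rewrite -mulmxA mulNP mulmxBr.
by rewrite !mulmxA NPN_NN opprB addrCA subrr addr0.
Qed.

Let half_adj : Num.conj (2%:R^-1 : C) = 2%:R^-1.
Proof. by rewrite fmorphV rmorph_nat. Qed.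

Let halfK (A : Mat) : 2%:R^-1 *: (2%:R *: A) = A.
Proof. by rewrite scalerA mulVf// scale1r. Qed.

Let PNNN : P *m N *m N *m N = 2%:R *: (P *m N).
Proof. by rewrite -!mulmxA (mulmxA N) NNN -scalemxAr. Qed.

Lemma src_mulP : a *m P = a.
Proof. by rewrite srcE -scalemxAl -!mulmxA (mulmxA N) NNP_PNN !mulmxA PP. Qed.

Lemma mulP_src : P *m a = a.
Proof. by rewrite srcE -scalemxAr !mulmxA PP. Qed.

Lemma src_adj : a ^t* = a.
Proof. by rewrite srcE adjmxZ !adjmxM NE PE mulmxA NNP_PNN half_adj. Qed.

Lemma mulN_src : N *m a = N *m P.
Proof. by rewrite srcE -scalemxAr !mulmxA NPN_NN mulmxBl NNN PNNN -scalerBr halfK mulNP. Qed.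

Lemma src_mulN : a *m N = P *m N.
Proof. by rewrite srcE -scalemxAl PNNN halfK. Qed.

Lemma src_idem : a *m a = a.
Proof. by rewrite {1}srcE -scalemxAl -!mulmxA mulN_src (mulmxA N) NNP_PNN !mulmxA PP srcE. Qed.

Lemma compl_mulN : c *m N = 0.
Proof. by rewrite src_complE mulmxBl src_mulN subrr. Qed.

Lemma mulP_compl : P *m c = c.
Proof. by rewrite src_complE mulmxBr PP mulP_src. Qed.

Lemma compl_mulP : c *m P = c.
Proof. by rewrite src_complE mulmxBl PP src_mulP. Qed.

Lemma compl_adj : c ^t* = c.
Proof. by rewrite src_complE adjmxB PE src_adj. Qed.

Lemma mulN_compl_eq0 : N *m c = 0.
Proof. by rewrite src_complE mulmxBr mulN_src subrr. Qed.

Lemma compl_src : c *m a = 0.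
Proof. by rewrite src_complE mulmxBl mulP_src src_idem subrr. Qed.

Lemma src_compl0 : a *m c = 0.
Proof. by rewrite src_complE mulmxBr src_mulP src_idem subrr. Qed.

Lemma src_add : a + c = P.
Proof. by rewrite src_complE addrCA subrr addr0. Qed.

Lemma tgt_adj : b ^t* = b.
Proof. by rewrite tgtE adjmxZ !adjmxM NE PE mulmxA half_adj. Qed.

Lemma tgt_mulN : b *m N = N *m P.
Proof. by rewrite tgtE -scalemxAl -[RHS]mulN_src srcE -scalemxAr !mulmxA. Qed.

Lemma tgt_mulP : b *m P = 0.
Proof. by rewrite tgtE -scalemxAl -!mulmxA (mulmxA P) PNP0 mulmx0 scaler0. Qed.

Lemma coP_mulN : (1%:M - P) *m N = N *m P.
Proof. by rewrite mulmxBl mul1mx mulNP. Qed.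

Lemma tgt_compl_mulN : e *m N = 0.
Proof. by rewrite tgt_complE mulmxBl coP_mulN tgt_mulN subrr. Qed.

Lemma tgt_compl_adj : e ^t* = e.
Proof. by rewrite tgt_complE !adjmxB adjmx1 PE tgt_adj. Qed.

Lemma mulN_tgt_compl : N *m e = 0.
Proof. by rewrite -[LHS]adjmxK adjmxM tgt_compl_adj NE tgt_compl_mulN trmx0 map_mx0. Qed.

Lemma tgt_compl_mulP : e *m P = 0.
Proof. by rewrite tgt_complE mulmxBl tgt_mulP subr0 mulmxBl mul1mx PP subrr. Qed.

Lemma mulP_tgt_compl : P *m e = 0.
Proof. by rewrite -[LHS]adjmxK adjmxM tgt_compl_adj PE tgt_compl_mulP trmx0 map_mx0. Qed.

Lemma tgt_compl_tgt : e *m b = 0.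
Proof. by rewrite tgtE -scalemxAr !mulmxA tgt_compl_mulN !mul0mx scaler0. Qed.

Lemma tgt_compl_idem : e *m e = e.
Proof. by rewrite [X in _ *m X]tgt_complE !mulmxBr mulmx1 tgt_compl_mulP tgt_compl_tgt !subr0. Qed.

Lemma tgt_add : b + e = 1%:M - P.
Proof. by rewrite tgt_complE addrC subrK. Qed.

(** Unit length means that N N has trace of real part 4; N N is the sum of P N N and N P N, which
    have equal traces, and P N N is Hermitian. *)
Lemma mxtrace_src : \tr a = 1.
Proof.
have re : complex.Re (\tr (P *m N *m N)) = 2.
  have E : N *m N = P *m N *m N + N *m P *m N by rewrite -mulmxDl PNNP.
  have [_ _ + _] := PN1; rewrite /metric E linearD.
  rewrite raddfD /= (mxtrace_mulC (N *m P) N) mulmxA NNP_PNN => ?; lra.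
have im : complex.Im (\tr (P *m N *m N)) = 0.
  have := congr1 (@complex.Im R) (mxtrace_adj (P *m N *m N)).
  by rewrite !adjmxM NE PE mulmxA NNP_PNN complex_ImJ => ?; lra.
have -> : \tr a = 2%:R^-1 * \tr (P *m N *m N) by rewrite srcE linearZ.
apply: (@mulfI _ 2%:R) => //; rewrite mulr1 mulrA divff// mul1r.
by rewrite -(rmorph_nat (real_complex R)) /= -re; case: (\tr _) im => x y /= ->.
Qed.

Lemma mxtrace_P : \tr P = 2%:R.
Proof. by have [_ _ rP] := gP; rewrite mxtrace_idempotent// rP. Qed.

Lemma src_neq0 : a != 0.
Proof. by apply: contra_eq_neq mxtrace_src => ->; rewrite mxtrace0 eq_sym oner_eq0. Qed.

Lemma src_compl_neq0 : c != 0.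
Proof.
have : \tr c = 1 by rewrite src_complE linearB /= mxtrace_P mxtrace_src; ring.
by apply: contra_eq_neq => ->; rewrite mxtrace0 eq_sym oner_eq0.
Qed.

(** The trace is n - 3, since V takes two dimensions and the line of w one. The bound on n thus
    makes D nonzero. *)
Lemma tgt_compl_neq0 : (3 < n)%N -> e != 0.
Proof.
move=> n3.
have trb : \tr b = 1.
  have trZ (A : Mat) : \tr (2%:R^-1 *: A) = 2%:R^-1 * \tr A by rewrite linearZ.
  rewrite -mxtrace_src tgtE srcE !trZ; congr (_ * _).
  by rewrite mxtrace_mulC mulmxA NNP_PNN.
have : \tr e = (n - 3)%:R.
  rewrite tgt_complE !linearB /= trb mxtrace_P mxtrace1 natrB; last exact: ltnW.
  by rewrite -addrA -opprD -[1]/(1%:R) -natrD.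
apply: contra_eq_neq => ->; rewrite mxtrace0 eq_sym pnatr_eq0.
by rewrite subn_eq0 -ltnNge.
Qed.

Lemma src_sandwich K : a *m K *m a = \tr (K *m a) *: a.
Proof. by apply: rank1_idempotent; [exact: src_idem|exact: mxtrace_src]. Qed.

End Identities.
Lemma mulNN_P P N : rank1_normal P N -> N *m N *m P = 2%:R *: src P N.
Proof. by move=> /NNP_PNN ->; rewrite srcE scalerA divff ?scale1r// pnatr_eq0. Qed.

Lemma tgt_mul P N W : tgt P N *m W = 2%:R^-1 *: (N *m (P *m N *m W)).
Proof. by rewrite tgtE -scalemxAl !mulmxA. Qed.

End NormalProjections.

(** * Block structure of first-order variations of P and N *)

Section NormalVariations.
Variables (R : realType) (n : nat).
Local Notation C := R[i].
Local Notation Mat := 'M[C]_n.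
Implicit Types P N K L X Y Z W Q B : Mat.

(** K is the elementary matrix linking the column of a nonzero entry of A to the row of a nonzero
    entry of B. *)
Lemma mulmx_sandwich_neq0 (A B : Mat) : A != 0 -> B != 0 ->
  exists K, A *m K *m B != 0.
Proof.
move=> /matrix0Pn[i [j Aij]] /matrix0Pn[k [l Bkl]].
exists (delta_mx j k); apply/matrix0Pn; exists i, l.
rewrite -(mul_delta_mx (0 : 'I_1)) !mulmxA -colE -mulmxA -rowE mxE big_ord1.
by rewrite !mxE mulf_neq0.
Qed.

Lemma of_homZ (k : R) K : of_hom (k%:C *: K) = k%:C *: of_hom K.
Proof.
rewrite /of_hom adjmxZ scalerDr; congr (_ + _ *: _).
by apply/eqP; rewrite eq_complex /= oppr0 !eqxx.
Qed.

Lemma tangent_of_hom P K : grass2 P -> P *m K = 0 -> K *m P = K ->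
  tangentG P (of_hom K).
Proof.
move=> gP PK KP; exists K => //=.
by rewrite /homVVperp /= /to_hom -mulmxA KP mulmxBl mul1mx PK subr0.
Qed.

Lemma of_hom_mulP P K : P ^t* = P -> P *m K = 0 -> K *m P = K ->
  of_hom K *m P = K.
Proof.
move=> PE PK KP; rewrite /of_hom mulmxDl KP.
have -> : K ^t* *m P = (P *m K) ^t* by rewrite adjmxM PE.
by rewrite PK trmx0 map_mx0 addr0.
Qed.

Lemma of_hom_mul_hom P K L : K *m P = K -> P *m L = 0 ->
  of_hom K *m L = K ^t* *m L.
Proof.
by move=> KP PL; rewrite /of_hom mulmxDl -{1}KP -mulmxA PL mulmx0 add0r.
Qed.

Lemma tangentGB P X Y (k : R) : grass2 P -> tangentG P X -> tangentG P Y ->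
  tangentG P (X - k%:C *: Y).
Proof.
move=> gP /(tangentGE _ gP)[XE XP] /(tangentGE _ gP)[YE YP].
apply/(tangentGE _ gP); split.
  rewrite adjmxB adjmxZ XE YE; congr (_ - _ *: _).
  by apply/eqP; rewrite eq_complex /= oppr0 !eqxx.
rewrite mulmxBr mulmxBl -scalemxAr -scalemxAl addrACA XP -opprD -scalerDr.
by rewrite YP.
Qed.

(** The cubic relation is the derivative of N^3 = 2 N, with W = dN. Between K and L, each term on
    its left has a factor N adjacent to K or to L. *)
Lemma cubic_variation_block_eq0 N W K L : K *m N = 0 -> N *m L = 0 ->
  W *m N *m N + N *m W *m N + N *m N *m W = 2%:R *: W -> K *m W *m L = 0.
Proof.
move=> KN NL /(congr1 (fun Z => K *m Z *m L)).
rewrite !mulmxDr !mulmxDl -!mulmxA NL !mulmx0 !(mulmxA K) KN !mul0mx !add0r.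
rewrite -scalemxAr -scalemxAl => /esym/eqP.
by rewrite scaler_eq0 pnatr_eq0 /= => /eqP.
Qed.

Section Identities.
Variables P N : Mat.
Hypothesis PN1 : rank1_normal P N.
Local Notation a := (src P N).
Local Notation c := (src_compl P N).
Local Notation b := (tgt P N).
Local Notation e := (tgt_compl P N).

Let gP : grass2 P. Proof. by case: PN1. Qed.
Let tN : tangentG P N. Proof. by case: PN1. Qed.
Let PE : P ^t* = P. Proof. by case: gP. Qed.
Let PP : P *m P = P. Proof. by case: gP. Qed.
Let NE : N ^t* = N. Proof. by case: ((tangentGE N gP).1 tN). Qed.
Let PNNP : P *m N + N *m P = N. Proof. by case: ((tangentGE N gP).1 tN). Qed.
Let PNP : P *m N *m P = 0. Proof. exact: PNP0. Qed.

Let NNP2 : N *m N *m P = 2%:R *: a.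
Proof. exact: mulNN_P. Qed.

Lemma normal_of_hom : of_hom (N *m P) = N.
Proof. by rewrite /of_hom adjmxM NE PE addrC. Qed.

Lemma JstrE : Jstr P N = of_hom ('i *: (N *m P)).
Proof. by rewrite /Jstr to_homN. Qed.

Lemma su2_mulP Q : su2 P Q -> P *m Q = Q /\ Q *m P = Q.
Proof. by case=> QP _ _; split; rewrite -[in LHS]QP ?mulmxA ?PP// -!mulmxA PP !mulmxA. Qed.

Lemma qstrE Q : qstr P Q N = of_hom (N *m P *m Q).
Proof. by rewrite /qstr to_homN. Qed.

Lemma tangent_qstr Q : su2 P Q -> tangentG P (qstr P Q N).
Proof.
move=> sQ; have [PQ QP] := su2_mulP sQ; rewrite qstrE; apply: tangent_of_hom => //.
  by rewrite !mulmxA PNP mul0mx.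
by rewrite -mulmxA QP.
Qed.

Lemma metric_normal_qstr Q : su2 P Q -> metric N (qstr P Q N) = 0.
Proof.
move=> sQ; have [_ QE _] := sQ; rewrite qstrE metric_of_hom// !mulmxA NNP2.
rewrite -scalemxAl linearZ /=.
have : \tr (a *m Q) = - Num.conj (\tr (a *m Q)).
  by rewrite -mxtrace_adj adjmxM QE (src_adj PN1) mulNmx linearN opprK mxtrace_mulC.
move=> /(congr1 (@complex.Re R)); rewrite raddfN /= complex_ReJ => re.
rewrite complex_ReM -(rmorph_nat (real_complex R)) /= mul0r subr0.
have -> : complex.Re (\tr (a *m Q)) = 0 by lra.
by rewrite mulr0 mul0r.
Qed.

(** These are the off-diagonal elements of su(V) for the splitting of V into the line of v and its
    complement. By [qstr_src_compl] they produce the directions of D^perp orthogonal to xi. *)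
Lemma su2_src_compl B : su2 P (a *m B *m c - c *m B ^t* *m a).
Proof.
split.
- rewrite mulmxBr mulmxBl !mulmxA (mulP_src PN1) (mulP_compl PN1).
  by rewrite -!mulmxA (compl_mulP PN1) (src_mulP PN1).
- by rewrite adjmxB !adjmxM adjmxK (src_adj PN1) (compl_adj PN1) opprB !mulmxA.
- have -> : \tr (a *m B *m c - c *m B ^t* *m a) =
      \tr (a *m B *m c) - \tr (c *m B ^t* *m a) by exact: raddfB.
  rewrite mxtrace_mulC mulmxA (compl_src PN1) mul0mx.
  by rewrite mxtrace_mulC mulmxA (src_compl0 PN1) mul0mx subrr.
Qed.

Lemma qstr_src_compl B :
  qstr P (a *m B *m c - c *m B ^t* *m a) N = of_hom (N *m P *m B *m c).
Proof.
rewrite qstrE mulmxBr !mulmxA -!(mulmxA N) (mulP_src PN1) (mulP_compl PN1).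
by rewrite !mulmxA (mulN_src PN1) (mulN_compl_eq0 PN1) !mul0mx subr0.
Qed.

Lemma tangent_dist K : tangentG P (of_hom (e *m K *m P)).
Proof.
apply: tangent_of_hom => //; last by rewrite -!mulmxA PP.
by rewrite !mulmxA (mulP_tgt_compl PN1) !mul0mx.
Qed.

Lemma metric_normal_dist K : metric N (of_hom (e *m K *m P)) = 0.
Proof.
by rewrite metric_of_hom// !mulmxA (mulN_tgt_compl PN1) !mul0mx mxtrace0 mul0r.
Qed.

Lemma of_hom_adj K : (of_hom K) ^t* = of_hom K.
Proof. by rewrite adjmxD adjmxK addrC. Qed.

Lemma dist_mulN K : of_hom (e *m K *m P) *m N = e *m K *m P *m N.
Proof.
by rewrite mulmxDl !adjmxM (tgt_compl_adj PN1) -!mulmxA (tgt_compl_mulN PN1)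
  !mulmx0 addr0.
Qed.

Lemma metric_dist_qstr K Q : metric (of_hom (e *m K *m P)) (qstr P Q N) = 0.
Proof.
rewrite qstrE metric_of_hom ?of_hom_adj// !mulmxA dist_mulN -!mulmxA.
by rewrite (mulmxA P N) (mulmxA (P *m N)) PNP mul0mx !mulmx0 mxtrace0 mul0r.
Qed.

(* The variations of P of the form of_hom (e K c) are those along which the
   normal does not change to first order: their image under the shape operator
   vanishes. *)
Lemma normal_variation_eq0 X W : X *m N = 0 -> N *m X = 0 -> W ^t* = W ->
  X *m N + P *m W + W *m P + N *m X = W -> metric N W = 0 ->
  (forall T, tangentG P T -> metric N T = 0 -> metric W T = 0) -> W = 0.
Proof.
move=> XN NX WE; rewrite XN NX add0r addr0 => WP NW WT.
have PWe : P *m W *m (1%:M - P) = 0.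
  apply: Re_mxtrace_nondegenerate => K.
  have tK : tangentG P (of_hom ((1%:M - P) *m K *m P)).
    apply: tangent_of_hom => //; last by rewrite -!mulmxA PP.
    by rewrite !mulmxA mulmxBr mulmx1 PP subrr !mul0mx.
  pose T := of_hom ((1%:M - P) *m K *m P)
    - (metric N (of_hom ((1%:M - P) *m K *m P)))%:C *: N.
  have : metric W T = 0.
    apply: WT; last by rewrite metricBr metricZr; have [_ _ -> _] := PN1; rewrite mulr1 subrr.
    exact: tangentGB.
  rewrite metricBr metricZr (metricC W N) NW mulr0 subr0 metric_of_hom//.
  move=> /eqP; rewrite mulf_eq0 invr_eq0 pnatr_eq0 orbF => /eqP <-.
  by rewrite !mulmxA [in RHS]mxtrace_mulC !mulmxA.
have PWP : P *m W *m P = 0 by exact: (tangent_sandwich PN1 WP).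
have PW : P *m W = 0.
  by move: PWe; rewrite mulmxBr mulmx1 PWP subr0.
have WP0 : W *m P = 0.
  by rewrite -[LHS]adjmxK adjmxM WE PE PW trmx0 map_mx0.
by rewrite -WP PW WP0 addr0.
Qed.

Lemma variation_block_eq0 W : W *m N *m N + N *m W *m N + N *m N *m W = 2%:R *: W ->
  e *m W *m c = 0.
Proof.
exact: cubic_variation_block_eq0 (tgt_compl_mulN PN1) (mulN_compl_eq0 PN1).
Qed.

(** Off-diagonal elements of su(V) kill the block beginning with c. In the block beginning with a, a
    scalar is left, whose real and imaginary parts are, up to factors, the products of W with N and
    J N. *)
Lemma variation_normal_block_eq0 W : W ^t* = W -> metric N W = 0 ->
  metric W (Jstr P N) = 0 -> (forall Q, su2 P Q -> metric W (qstr P Q N) = 0) ->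
  P *m W *m N *m P = 0.
Proof.
move=> WE NW WJ WQ.
have half0 (x : R) : x / 2 = 0 -> x = 0.
  by move=> /eqP; rewrite mulf_eq0 invr_eq0 pnatr_eq0 orbF => /eqP.
have cWNP : c *m W *m N *m P = 0.
  apply: Re_mxtrace_nondegenerate => B.
  have := WQ _ (su2_src_compl B); rewrite qstr_src_compl metric_of_hom//.
  by move=> /half0 <-; rewrite !mulmxA [in RHS]mxtrace_mulC !mulmxA.
have trWNP : \tr (W *m N *m P) = 0.
  have re : complex.Re (\tr (W *m N *m P)) = 0.
    by apply: half0; rewrite -mulmxA -metric_of_hom// normal_of_hom metricC.
  have im : complex.Re ('i * \tr (W *m N *m P)) = 0.
    by apply: half0; rewrite -WJ JstrE metric_of_hom// -scalemxAr linearZ /= mulmxA.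
  case: (\tr _) re im => x y /= ->; rewrite !mul0r mul1r sub0r => /eqP.
  by rewrite oppr_eq0 => /eqP ->.
have aWNP : a *m W *m N *m P = 0.
  rewrite -mulmxA -(mulN_src PN1) !mulmxA -(mulmxA a) (src_sandwich PN1).
  by rewrite -mulmxA (mulN_src PN1) mulmxA trWNP scale0r.
have := congr2 +%R aWNP cWNP; rewrite addr0 => <-.
by rewrite -!mulmxDl src_add.
Qed.

(** The source of the curvature term, with W = dN and Y = dP along one direction and X = dP along
    another. Since P W N P = 0, the product X W N P only involves the block of W on V^perp, which
    the last hypothesis identifies with that of Y N + N Y; as X N = 0, there remains X Y N N P = 2 X
    Y P. *)
Lemma metric_variation_of_hom B X Y W : W ^t* = W -> X *m N = 0 ->
  Y *m P = Y *m a -> P *m W *m N *m P = 0 ->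
  Y *m N + P *m W + W *m P + N *m Y = W ->
  metric W (of_hom (N *m P *m B *m X)) = complex.Re (\tr (B *m X *m Y *m P)).
Proof.
move=> WE XN YP PWNP WY; rewrite metric_of_hom//.
have YNNP : Y *m (N *m N *m P) = 2%:R *: (Y *m P).
  by rewrite NNP2 -scalemxAr YP.
have XWNP : X *m W *m N *m P = 2%:R *: (X *m Y *m P).
  rewrite -{1}WY !mulmxDr !mulmxDl.
  rewrite !mulmxA XN !mul0mx addr0.
  rewrite -!mulmxA (mulmxA W N) (mulmxA P (W *m N)) (mulmxA P W) PWNP mulmx0 addr0.
  rewrite (mulmxA P N) PNP !mulmx0 addr0 (mulmxA N N).
  by rewrite YNNP -scalemxAr.
have -> : \tr (W *m (N *m P *m B *m X)) = \tr (B *m (X *m W *m N *m P)).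
  have -> : W *m (N *m P *m B *m X) = (W *m N *m P) *m (B *m X) by rewrite !mulmxA.
  by rewrite mxtrace_mulC !mulmxA.
rewrite XWNP -scalemxAr linearZ /= complex_ReM -(rmorph_nat (real_complex R)) /=.
by rewrite !mulmxA mul0r subr0; field.
Qed.

(** In the map of V into V^perp given by W, orthogonality to D kills the part with values outside
    the line of w, and the last condition kills the part on the complement of v. A complex multiple
    of N P is left; orthogonality to N makes the factor imaginary. *)
Lemma reeb_direction W : W ^t* = W -> metric N W = 0 ->
  (forall K, metric W (of_hom (e *m K *m P)) = 0) -> c *m W *m N *m P = 0 ->
  exists nu : R, tproj P W = nu%:C *: Jstr P N.
Proof.
move=> WE NW We cWNP.
have half0 (x : R) : x / 2 = 0 -> x = 0.
  by move=> /eqP; rewrite mulf_eq0 invr_eq0 pnatr_eq0 orbF => /eqP.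
have eWP : e *m W *m P = 0.
  have : P *m W *m e = 0.
    apply: Re_mxtrace_nondegenerate => K.
    have := We K; rewrite metric_of_hom// => /half0 <-.
    by rewrite !mulmxA [in RHS]mxtrace_mulC !mulmxA.
  move/(congr1 (fun Z => Z ^t* )).
  by rewrite /= !adjmxM WE PE (tgt_compl_adj PN1) trmx0 map_mx0 mulmxA.
have PNWc : P *m N *m W *m c = 0.
  have /(congr1 (fun Z => Z ^t* )) := cWNP.
  by rewrite /= !adjmxM WE PE NE (compl_adj PN1) trmx0 map_mx0 !mulmxA.
pose mu := \tr (W *m (P *m N)).
have PNWa : P *m N *m W *m a = mu *: a.
  rewrite -(src_mulN PN1) -(mulmxA a) (src_sandwich PN1); congr (_ *: _).
  by rewrite -mulmxA mxtrace_mulC -mulmxA (src_mulN PN1).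
have homW : to_hom P W = (2%:R^-1 * mu) *: (N *m P).
  have -> : to_hom P W = b *m W *m P + e *m W *m P.
    by rewrite -!mulmxDl tgt_add.
  rewrite eWP addr0 tgt_mul -scalemxAl -mulmxA.
  have -> : P *m N *m W *m P = mu *: a.
    by rewrite -[X in _ *m X](src_add P N) [LHS]mulmxDr PNWa PNWc addr0.
  by rewrite -scalemxAr (mulN_src PN1) scalerA.
have remu : complex.Re mu = 0.
  apply: half0; rewrite /mu mxtrace_mulC -[X in \tr X]adjmxK mxtrace_adj complex_ReJ.
  by rewrite !adjmxM WE PE NE -metric_of_hom// normal_of_hom metricC.
exists (2^-1 * complex.Im mu).
rewrite /tproj homW JstrE -of_homZ scalerA; congr (of_hom (_ *: _)).
clear PNWa homW; clearbody mu; case: mu remu => x y /= ->.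
rewrite -(rmorph_nat (real_complex R)) -fmorphV.
by apply/eqP; rewrite eq_complex /=; apply/andP; split; apply/eqP; ring.
Qed.

Lemma mulP_dist K L : P *m (e *m K *m L) = 0.
Proof. by rewrite !mulmxA (mulP_tgt_compl PN1) !mul0mx. Qed.

Lemma dist_compl_mulP K : e *m K *m c *m P = e *m K *m c.
Proof. exact: etrans (esym (mulmxA _ _ _)) (congr1 (mulmx _) (compl_mulP PN1)). Qed.

Lemma dist_src_mulP K : e *m K *m a *m P = e *m K *m a.
Proof. exact: etrans (esym (mulmxA _ _ _)) (congr1 (mulmx _) (src_mulP PN1)). Qed.

(** The product X Y P is the adjoint of e K c times e L a, so K and then L are found by sandwiching
    nonzero matrices. This provides a nonvanishing curvature term. *)
Lemma exists_dist_variations : (3 < n)%N -> exists K L,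
  let X := of_hom (e *m K *m c) in let Y := of_hom (e *m L *m a) in
  X *m Y *m P != 0.
Proof.
move=> n3.
have [K xn0] := mulmx_sandwich_neq0 (tgt_compl_neq0 PN1 n3) (src_compl_neq0 PN1).
have xan0 : (e *m K *m c) ^t* != 0.
  by apply: contra_neq xn0 => /(congr1 (fun Z => Z ^t* )); rewrite /= adjmxK trmx0 map_mx0.
have [L yn0] := mulmx_sandwich_neq0 xan0 (src_neq0 PN1).
exists K, L => /=; apply: contra_neq yn0 => XYP.
move: XYP; rewrite -mulmxA (of_hom_mulP PE (mulP_dist L a) (dist_src_mulP L)).
rewrite (of_hom_mul_hom (dist_compl_mulP K) (mulP_dist L a)) => <-.
rewrite !adjmxM (tgt_compl_adj PN1) !mulmxA.
have -> : c ^t* *m K ^t* *m e *m e = c ^t* *m K ^t* *m e.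
  by rewrite -mulmxA (tgt_compl_idem PN1).
by [].
Qed.

(** Here W is dN along a direction in D_+, and H = e W P represents its D component. H kills the
    complement of v and is nonzero, so H^* H is a nonzero multiple lam of a; this lets H be inverted
    on the line of v. *)
Lemma compl_reeb_eq0 W Wxi K0 : e *m W *m c = 0 -> W ^t* = W ->
  P *m W *m of_hom (e *m K0 *m c) *m P != 0 -> Wxi ^t* = Wxi ->
  (forall K, metric Wxi (of_hom (N *m P *m W *m of_hom (e *m K *m c) *m P)) = 0) ->
  c *m Wxi *m N *m P = 0.
Proof.
move=> eWc WE; have XP K : of_hom (e *m K *m c) *m P = e *m K *m c.
  exact: of_hom_mulP PE (mulP_dist K c) (dist_compl_mulP K).
rewrite -[X in X != 0 -> _]mulmxA XP => h0 WxE hK.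
pose H := e *m W *m P.
have HE : H ^t* = P *m W *m e by rewrite !adjmxM PE WE (tgt_compl_adj PN1) mulmxA.
have Ha : H *m a = H.
  by rewrite /H -[X in _ = _ *m X](src_add P N) [RHS]mulmxDr eWc addr0 -mulmxA (mulP_src PN1).
have Hn0 : H != 0.
  apply: contra_neq h0 => H0; rewrite !mulmxA -HE H0 trmx0 map_mx0.
  by rewrite !mul0mx.
clearbody H.
have aH : a *m H ^t* = H ^t* by rewrite -{2}Ha adjmxM (src_adj PN1).
pose lam := \tr (H ^t* *m H *m a).
have HH : H ^t* *m H = lam *: a.
  have -> : H ^t* *m H = a *m (H ^t* *m H) *m a.
    by rewrite mulmxA aH -mulmxA Ha.
  by rewrite (src_sandwich PN1).
have lam0 : lam != 0.
  apply: contra_neq Hn0 => l0; have /(congr1 (fun Z => Z ^t* )) :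
    H ^t* = 0; last by rewrite /= adjmxK trmx0 map_mx0.
  by apply: mulmx_adj_eq0; rewrite adjmxK HH l0 scale0r.
apply: Re_mxtrace_nondegenerate => L.
(* With this K the tested map becomes N P L c. As L is arbitrary, these exhaust the part of D^perp
   orthogonal to xi. *)
have := hK (H *m (lam^-1 *: L)).
rewrite -[X in of_hom X]mulmxA XP metric_of_hom//.
have -> : N *m P *m W *m (e *m (H *m (lam^-1 *: L)) *m c) = N *m P *m L *m c.
  have -> : N *m P *m W *m (e *m (H *m (lam^-1 *: L)) *m c) =
    N *m (P *m W *m e *m H *m (lam^-1 *: L)) *m c by rewrite !mulmxA.
  have -> : P *m W *m e *m H *m (lam^-1 *: L) = a *m L.
    by rewrite -HE HH -scalemxAr -scalemxAl scalerA mulVf// scale1r.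
  by rewrite mulmxA (mulN_src PN1).
move=> /eqP; rewrite mulf_eq0 invr_eq0 pnatr_eq0 orbF => /eqP <-.
by rewrite !mulmxA [in RHS]mxtrace_mulC !mulmxA.
Qed.

Lemma compl_block_mulN K : of_hom (e *m K *m c) *m N = 0.
Proof.
rewrite /of_hom mulmxDl.
have -> : e *m K *m c *m N = 0 by rewrite -[LHS]mulmxA (compl_mulN PN1) mulmx0.
have -> : (e *m K *m c) ^t* *m N = (N *m (e *m K *m c)) ^t* by rewrite [RHS]adjmxM NE.
by rewrite !mulmxA (mulN_tgt_compl PN1) !mul0mx trmx0 map_mx0 addr0.
Qed.

Lemma block_dist_eq0 Y L : Y = of_hom (e *m L *m a) -> N *m P *m N *m Y = 0.
Proof.
move=> ->; rewrite /of_hom mulmxDr.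
have -> : N *m P *m N *m (e *m L *m a) = 0.
  rewrite !mulmxA -[X in X *m L]mulmxA (mulN_tgt_compl PN1) mulmx0.
  by rewrite !mul0mx.
have -> : (e *m L *m a) ^t* = P *m (e *m L *m a) ^t*.
  have := congr1 (fun Z => Z ^t* ) (dist_src_mulP L).
  by rewrite /= adjmxM PE => ->.
rewrite mulmxA -[X in X *m _]mulmxA.
have -> : N *m P *m (N *m P) = 0 by rewrite -mulmxA (mulmxA P) PNP mulmx0.
by rewrite mul0mx add0r.
Qed.

Lemma dist_src_block Y L : Y = of_hom (e *m L *m a) -> Y *m P = Y *m a.
Proof.
move=> ->; rewrite (of_hom_mulP PE (mulP_dist L a) (dist_src_mulP L)).
rewrite /of_hom mulmxDl.
have -> : e *m L *m a *m a = e *m L *m a by rewrite -[LHS]mulmxA (src_idem PN1).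
have -> : (e *m L *m a) ^t* *m a = (a *m (e *m L *m a)) ^t*.
  by rewrite [RHS]adjmxM (src_adj PN1).
have -> : a *m (e *m L *m a) = 0.
  by rewrite -(src_mulP PN1) -mulmxA mulP_dist mulmx0.
by rewrite trmx0 map_mx0 addr0.
Qed.

End Identities.
End NormalVariations.
(** * The tangent space of a hypersurface *)

Section TangentDimension.
Variables (R : realType) (m d : nat).
Local Notation C := R[i].
Local Notation Mat := 'M[C]_(m + 2).
Implicit Types P N X : Mat.

Lemma tangentGD P X Y : grass2 P -> tangentG P X -> tangentG P Y ->
  tangentG P (X + Y).
Proof.
move=> gP /(tangentGE _ gP)[XE XP] /(tangentGE _ gP)[YE YP].
apply/(tangentGE _ gP); split; first by rewrite adjmxD XE YE.
by rewrite mulmxDr mulmxDl addrACA XP YP.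
Qed.

Lemma tangentGZ P (k : R) X : grass2 P -> tangentG P X -> tangentG P (k%:C *: X).
Proof.
move=> gP /(tangentGE _ gP)[XE XP]; apply/(tangentGE _ gP); split.
  rewrite adjmxZ XE; congr (_ *: _).
  by apply/eqP; rewrite eq_complex /= oppr0 !eqxx.
by rewrite -scalemxAr -scalemxAl -scalerDr XP.
Qed.

(** A map of V into V^perp is determined by its m x 2 block in bases of the two spaces, that is by 4
    m real coordinates. *)
Lemma tangentG_coords P : grass2 P ->
  exists (D : 'M[C]_(m, m + 2)) (B : 'M[C]_(m + 2, 2)), forall X,
    tangentG P X -> D *m X *m B = 0 -> X = 0.
Proof.
move=> gP; have [PE PP rP] := gP.
have QQ : (1%:M - P) *m (1%:M - P) = 1%:M - P.
  by rewrite mulmxBr mulmx1 mulmxBl mul1mx PP subrr subr0.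
have rQ : \rank (1%:M - P) = m.
  apply/eqP; rewrite -(eqr_nat C) -mxtrace_idempotent//.
  by rewrite linearB /= mxtrace1 mxtrace_idempotent// rP natrD addrK.
have := idempotent_factor PP; rewrite rP => -[B [D [PBD DB]]].
have := idempotent_factor QQ; rewrite rQ => -[B' [D' [QBD DB']]].
exists D', B => X [phi phiE <-] h.
suff -> : phi = 0 by rewrite /of_hom trmx0 map_mx0 addr0.
have hE : to_hom P (of_hom phi) = phi by exact: of_homK.
rewrite -hE /to_hom QBD PBD.
have -> : B' *m D' *m of_hom phi *m (B *m D) = B' *m (D' *m of_hom phi *m B) *m D.
  by rewrite !mulmxA.
by rewrite h mulmx0 mul0mx.
Qed.

(** A dimension count. The map sending (s, v) to s N + L v, read in 4 m real coordinates, is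
    injective because the product with N recovers s. Since 1 + d = 4 m it is surjective, and a
    vector orthogonal to N has s = 0. *)
Lemma hypersurface_tangent_surj P N (L : 'rV[R]_d -> Mat) : d.+1 = (4 * m)%N ->
  grass2 P -> tangentG P N -> metric N N = 1 ->
  (forall a v w, L (a *: v + w) = a%:C *: L v + L w) -> injective L ->
  (forall v, tangentG P (L v) /\ metric N (L v) = 0) ->
  forall X, tangentG P X -> metric N X = 0 -> exists v, L v = X.
Proof.
move=> dm gP tN NN Llin Linj Lt X tX NX.
have [D [B DB]] := tangentG_coords gP.
have L0 : L 0 = 0.
  by have := Llin (-1) 0 0; rewrite scaler0 addr0 rmorphN1 scaleN1r addNr.
pose phi (Y : Mat) : 'rV[R]_(m * 2 + m * 2) :=
  row_mx (mxvec (map_mx (@complex.Re R) (D *m Y *m B)))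
         (mxvec (map_mx (@complex.Im R) (D *m Y *m B))).
have phi_inj Y : tangentG P Y -> phi Y = 0 -> Y = 0.
  move=> tY; rewrite -[0]row_mx0 => /eq_row_mx[re im]; apply: DB => //.
  have {}re := congr1 vec_mx re; have {}im := congr1 vec_mx im.
  move: re im; rewrite !mxvecK !linear0 => re im.
  apply/matrixP => i j; apply/eqP; rewrite eq_complex.
  have := congr1 (fun A : 'M[R]_(m, 2) => A i j) re.
  have := congr1 (fun A : 'M[R]_(m, 2) => A i j) im.
  by rewrite [LHS]mxE [RHS]mxE => -> ; rewrite [LHS]mxE [RHS]mxE => ->;
    rewrite mxE !eqxx.
have phi_lin (a : R) Y Z : phi (a%:C *: Y + Z) = a *: phi Y + phi Z.
  have E : D *m (a%:C *: Y + Z) *m B = a%:C *: (D *m Y *m B) + D *m Z *m B.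
    by rewrite mulmxDr mulmxDl -scalemxAr -scalemxAl.
  rewrite /phi E; move: (D *m Y *m B) (D *m Z *m B) => Y' Z'.
  rewrite scale_row_mx add_row_mx -!linearP; congr (row_mx (mxvec _) (mxvec _));
    by apply/matrixP => i j; rewrite !mxE raddfD /= ?complex_ReM ?complex_ImM /= mul0r
      ?subr0 ?addr0.
pose h (w : 'rV[R]_(1 + d)) := phi ((w 0 (lshift d 0))%:C *: N + L (rsubmx w)).
have hlin : linear h.
  move=> a v w; rewrite /h -phi_lin; congr phi.
  rewrite linearP Llin !mxE rmorphD rmorphM scalerDl scalerDr scalerA.
  by rewrite !addrA; congr (_ + _); rewrite addrAC.
pose hL : {linear 'rV[R]_(1 + d) -> 'rV[R]_(m * 2 + m * 2)} :=
  HB.pack h (GRing.isLinear.Build _ _ _ _ h hlin).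
pose M := lin1_mx hL.
have ME w : w *m M = h w by rewrite mul_rV_lin1.
have tw (s : R) v : tangentG P (s%:C *: N + L v).
  by apply: tangentGD => //; [exact: tangentGZ|exact: (Lt v).1].
have Ns (s : R) v : metric N (s%:C *: N + L v) = s.
  by rewrite metricDr metricZr NN mulr1 (Lt v).2 addr0.
have Mfree : row_free M.
  apply: inj_row_free => w; rewrite ME => /phi_inj-/(_ (tw _ _)) w0.
  have s0 : w 0 (lshift d 0) = 0.
    by rewrite -(Ns (w 0 (lshift d 0)) (rsubmx w)) w0 /metric mulmx0 mxtrace0 /= mul0r.
  move: w0; rewrite s0 scale0r add0r -L0 => /Linj w0.
  rewrite -[w]hsubmxK w0; apply/rowP => i; rewrite !mxE.
  case: splitP => j ij; last by rewrite mxE.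
  rewrite mxE -s0; congr (w _ _); apply: val_inj => /=.
  by rewrite (ord1 j).
have Mfull : row_full M.
  move: Mfree; rewrite /row_free /row_full => /eqP ->.
  by rewrite add1n dm -mulnDr mulnC.
have /submxP[w] := submx_full (phi X) Mfull; rewrite ME => XE.
exists (rsubmx w).
set s := w 0 (lshift d 0); set v := rsubmx w.
have E : s%:C *: N + L v = X.
  apply/eqP; rewrite -subr_eq0; apply/eqP; apply: phi_inj.
    rewrite -[X in _ - X]scale1r; rewrite -[1]/((1 : R)%:C).
    exact: tangentGB.
  have := phi_lin (-1) X (s%:C *: N + L v).
  rewrite XE scaleN1r addNr => <-; congr phi.
  by rewrite rmorphN1 scaleN1r addrC.
by have := Ns s v; rewrite E NX => s0; rewrite -E -s0 scale0r add0r.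
Qed.

End TangentDimension.

(** * Change of charts *)

Section ChangeOfCharts.
Variables (R : realType) (d n : nat) (M : smooth_manifold R d).
Local Notation Mat := 'M[R[i]]_n.
Implicit Types (c b : chart R d M) (p : M).

(** The chain rule for G read in c after the transition map. This composite agrees with G read in b
    only near the point, where [cinv b] still lands in the domain of c. *)
Lemma derive_transition (W : normedModType R) (G : M -> W) b c p v :
  cdom b p -> cdom c p -> differentiable (transition b c) (cmap b p) ->
  differentiable (G \o cinv c) (cmap c p) ->
  'D_v (G \o cinv b) (cmap b p) =
  'D_('D_v (transition b c) (cmap b p)) (G \o cinv c) (cmap c p).
Proof.
move=> bp cp dt dG.
have pE : cinv b (cmap b p) = p by exact: cmapK.
have tE : transition b c (cmap b p) = cmap c p by rewrite /transition /= pE.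
have bx : (cmap b @` cdom b) (cmap b p) by exists p.
have cb := cinv_continuous bx.
have near_dom : \forall y \near cmap b p, cdom c (cinv b y).
  apply: cb; rewrite pE; apply: open_nbhs_nbhs; split => //.
  exact: cdom_open.
rewrite -tE in dG.
have -> : 'D_v (G \o cinv b) (cmap b p) =
    'D_v ((G \o cinv c) \o transition b c) (cmap b p).
  apply: near_eq_derive; apply: filterS near_dom => y cy /=.
  by rewrite /transition /= cmapK.
rewrite (deriveE v (differentiable_comp dt dG)) (diff_comp dt dG).
by rewrite /= -(deriveE v dt) tE -deriveE// -tE.
Qed.

Lemma cderive_transition (G : M -> Mat) b c p v :
  cdom b p -> cdom c p -> smooth_compatible b c ->
  csmooth_on (cimage c) (G \o cinv c) ->
  cderive v (G \o cinv b) (cmap b p) =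
  cderive ('D_v (transition b c) (cmap b p)) (G \o cinv c) (cmap c p).
Proof.
move=> bp cp [sbc _] [sr si].
have cx : cimage c (cmap c p) by exists p.
have dt : differentiable (transition b c) (cmap b p).
  by apply: smooth_on_differentiable sbc _; exists p.
apply: (congr2 (@complex_mx R n)).
  exact: (derive_transition v bp cp dt (G := @mxRe R n \o G)
    (smooth_on_differentiable sr cx)).
exact: (derive_transition v bp cp dt (G := @mxIm R n \o G)
    (smooth_on_differentiable si cx)).
Qed.

Lemma dmxE (G : M -> Mat) p v :
  dmx G p v = cderive v (G \o cinv (chart_at p)) (cmap (chart_at p) p).
Proof. by []. Qed.

Lemma smooth_mx_csmooth_on (G : M -> Mat) p : smooth_mx G ->
  csmooth_on (cimage (chart_at p)) (G \o cinv (chart_at p)).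
Proof. by move=> /(_ p). Qed.

(** Facts on M at q refer to the preferred chart of q, whereas second derivatives need one fixed
    chart. This lemma and the next translate between the two. *)
Lemma cderive_dmx (G : M -> Mat) p q v : smooth_mx G -> cdom (chart_at p) q ->
  cderive v (G \o cinv (chart_at p)) (cmap (chart_at p) q) =
  dmx G q ('D_v (transition (chart_at p) (chart_at q)) (cmap (chart_at p) q)).
Proof.
move=> sG pq; exact: (cderive_transition v pq (mem_chart_at q)
  (chart_at_compatible p q) (smooth_mx_csmooth_on q sG)).
Qed.

Lemma dmx_cderive (G : M -> Mat) p q v : smooth_mx G -> cdom (chart_at p) q ->
  dmx G q v =
  cderive ('D_v (transition (chart_at q) (chart_at p)) (cmap (chart_at q) q))
    (G \o cinv (chart_at p)) (cmap (chart_at p) q).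
Proof.
move=> sG pq; exact: (cderive_transition v (mem_chart_at q) pq
  (chart_at_compatible q p) (smooth_mx_csmooth_on p sG)).
Qed.

End ChangeOfCharts.

(** * The Codazzi equation *)

Section MetricDerivative.
Variables (R : realType) (n : nat) (V : normedModType R).
Local Notation Mat := 'M[R[i]]_n.
Implicit Types (F G Z : V -> Mat) (x v : V).

Lemma metric0r (X : Mat) : metric X 0 = 0 :> R.
Proof. by rewrite /metric mulmx0 mxtrace0 /= mul0r. Qed.

Lemma metric0l (X : Mat) : metric 0 X = 0 :> R.
Proof. by rewrite metricC metric0r. Qed.

Lemma metric_suml (I : finType) (a : I -> R) (X : I -> Mat) (Y : Mat) :
  metric (\sum_k (a k)%:C *: X k) Y = \sum_k a k * metric (X k) Y.
Proof.
rewrite (big_morph (fun A => metric A Y) (fun A B => metricDl A B Y) (metric0l Y)).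
by apply: eq_bigr => k _; rewrite metricC metricZr metricC.
Qed.

Lemma is_derive_metric x v F G A B :
  mx_is_derive x v F A -> mx_is_derive x v G B ->
  is_derive x v (fun y => metric (F y) (G y)) (metric A (G x) + metric (F x) B).
Proof.
move=> dF dG; have dM := mx_is_deriveM dF dG.
have dtr : is_derive x v (fun y => complex.Re (\tr (F y *m G y)))
    (complex.Re (\tr (A *m G x + F x *m B))).
  rewrite /mxtrace raddf_sum; under eq_fun do rewrite raddf_sum.
  by apply: is_derive_sumr => k; have [] := dM k k.
have -> : (fun y => metric (F y) (G y)) =
    (4^-1 : R) *: (fun y => complex.Re (\tr (F y *m G y))).
  by apply/funext => y; rewrite /metric mulrC.
have -> : metric A (G x) + metric (F x) B =
    (4^-1 : R) *: complex.Re (\tr (A *m G x + F x *m B)).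
  by rewrite /metric raddfD raddfD /= [RHS]mulrC mulrDl.
exact: is_deriveZ.
Qed.

Lemma mx_is_derive_of_hom x v F A : mx_is_derive x v F A ->
  mx_is_derive x v (fun y => of_hom (F y)) (of_hom A).
Proof. by move=> dF; apply: mx_is_deriveD => //; exact: mx_is_derive_adj. Qed.

Lemma is_derive_cvg_metric x v Z A (X : Mat) : mx_is_derive x v Z A ->
  metric (Z (h *: v + x)) X @[h --> 0^'] --> metric (Z x) X.
Proof.
move=> dZ; apply: (@is_derive_cvg _ _ x v (fun y => metric (Z y) X)).
exact: is_derive_metric dZ (mx_is_derive_cst x v X).
Qed.

Lemma metric_self_eq0 (X : Mat) : X ^t* = X -> metric X X = 0 -> X = 0.
Proof.
move=> XE /eqP; rewrite /metric mulf_eq0 invr_eq0 pnatr_eq0 orbF => /eqP h.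
by apply: Re_mxtrace_mul_adj_eq0; rewrite XE.
Qed.

Lemma of_homD (K L : Mat) : of_hom (K + L) = of_hom K + of_hom L.
Proof. by rewrite /of_hom adjmxD addrACA. Qed.

Lemma of_hom0 : of_hom (0 : Mat) = 0.
Proof. by rewrite /of_hom trmx0 map_mx0 addr0. Qed.

End MetricDerivative.

(** The difference of the identity of [is_derive_shape_dperp] for (u, v) and for (v, u). The second
    derivatives W2 of N and X2 of P cancel by symmetry, and W0, the derivative of N along u, is
    0. *)
Lemma codazzi_combine (R : realType) n (P N X Y W0 W W2 W2' X2 X2' Z Zu Zv Wz :
    'M[R[i]]_n) :
  W2 = W2' -> X2 = X2' -> W0 = 0 -> N *m X = 0 -> N *m P *m N *m Y = 0 ->
  metric W2 Z + metric W Zu = 2^-1 * metric Wz (of_hom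
    ((((W0 *m P + N *m X) *m N + N *m P *m W0) *m Y + N *m P *m N *m X2) *m P +
     N *m P *m N *m Y *m X)) ->
  metric W2' Z + metric W0 Zv = 2^-1 * metric Wz (of_hom
    ((((W *m P + N *m Y) *m N + N *m P *m W) *m X + N *m P *m N *m X2') *m P +
     N *m P *m N *m X *m Y)) ->
  metric W Zu = - 2^-1 * metric Wz (of_hom (N *m P *m W *m X *m P)).
Proof.
move=> <- <- -> NX BY.
rewrite NX BY !(mul0mx, mulmx0, add0r, addr0).
have -> : N *m P *m N *m X = 0 by rewrite -mulmxA NX mulmx0.
have -> : ((W *m P + N *m Y) *m N + N *m P *m W) *m X = N *m P *m W *m X.
  by rewrite mulmxDl -mulmxA NX mulmx0 add0r.
rewrite !(mul0mx, mulmx0, add0r, addr0) mulmxDl of_homD metricDr metric0l.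
have solve (a b c e : R) : a + b = 2^-1 * c -> a + 0 = 2^-1 * (e + c) ->
    b = - 2^-1 * e.
  by move=> h1 h2; lra.
exact (solve _ _ _ _).
Qed.

(** * The hypersurface in a single chart *)

Section LocalHypersurface.
Variables (R : realType) (d n : nat).
Local Notation V := 'rV[R]_d.
Local Notation Mat := 'M[R[i]]_n.
Variables (U : set V) (F N : V -> Mat).
Hypotheses (oU : open U) (sF : csmooth_on U F) (sN : csmooth_on U N).
Hypothesis FN1 : forall x, U x -> rank1_normal (F x) (N x).
Hypothesis normalN : forall x v, U x -> metric (N x) (cderive v F x) = 0.
Hypothesis tangent_surj : forall x X, U x -> tangentG (F x) X ->
  metric (N x) X = 0 -> exists v, cderive v F x = X.
Hypothesis dist_invariant : forall x v, U x ->
  (forall Q, su2 (F x) Q -> metric (cderive v F x) (qstr (F x) Q (N x)) = 0) ->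
  forall Q, su2 (F x) Q -> metric (cderive v N x) (qstr (F x) Q (N x)) = 0.

Let gF x : U x -> grass2 (F x). Proof. by move=> /FN1[]. Qed.
Let tN x : U x -> tangentG (F x) (N x). Proof. by move=> /FN1[]. Qed.
Let dF x v (Ux : U x) := csmooth_is_derive v sF Ux.
Let dN x v (Ux : U x) := csmooth_is_derive v sN Ux.
Let ddF x u v (Ux : U x) := csmooth_is_derive u (csmooth_on_derive v sF) Ux.
Let ddN x u v (Ux : U x) := csmooth_is_derive u (csmooth_on_derive v sN) Ux.

(** The device by which the identities P P = P, P N + N P = N and N^3 = 2 N, valid on all of U, are
    differentiated. *)
Lemma derive_eq_on x v (G H : V -> Mat) A B : U x ->
  (forall y, U y -> G y = H y) -> mx_is_derive x v G A -> mx_is_derive x v H B ->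
  A = B.
Proof.
move=> Ux GH dG; apply: mx_is_derive_unique; apply: near_mx_is_derive dG.
by apply: filterS (open_nbhs_nbhs (conj oU Ux)).
Qed.

Lemma derive_eq_onR x v (g h : V -> R) a b : U x ->
  (forall y, U y -> g y = h y) -> is_derive x v g a -> is_derive x v h b -> a = b.
Proof.
move=> Ux gh dg dh.
have [_ <-] := dh; apply/esym; apply: (@derive_val _ _ _ _ _ _ _ _).
apply: near_eq_is_derive dg.
by apply: filterS (open_nbhs_nbhs (conj oU Ux)).
Qed.

Lemma variation_adj x v : U x -> (cderive v F x) ^t* = cderive v F x.
Proof.
move=> Ux; apply: (derive_eq_on Ux _ (mx_is_derive_adj (dF v Ux)) (dF v Ux)) => y Uy.
by have [] := gF Uy.
Qed.

Lemma normal_adj x v : U x -> (cderive v N x) ^t* = cderive v N x.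
Proof.
move=> Ux; apply: (derive_eq_on Ux _ (mx_is_derive_adj (dN v Ux)) (dN v Ux)) => y Uy.
by have [] := (tangentGE _ (gF Uy)).1 (tN Uy).
Qed.

Lemma variation_tangent x v : U x -> tangentG (F x) (cderive v F x).
Proof.
move=> Ux; apply/(tangentGE _ (gF Ux)); split; first exact: variation_adj.
rewrite addrC.
apply: (derive_eq_on Ux _ (mx_is_deriveM (dF v Ux) (dF v Ux)) (dF v Ux)) => y Uy.
by have [] := gF Uy.
Qed.

Lemma normal_variation x v : U x ->
  cderive v F x *m N x + F x *m cderive v N x + cderive v N x *m F x +
  N x *m cderive v F x = cderive v N x.
Proof.
move=> Ux; rewrite -addrA.
apply: (derive_eq_on Ux _ (mx_is_deriveD (mx_is_deriveM (dF v Ux) (dN v Ux))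
  (mx_is_deriveM (dN v Ux) (dF v Ux))) (dN v Ux)) => y Uy.
by have [] := (tangentGE _ (gF Uy)).1 (tN Uy).
Qed.

Lemma normal_cubic_variation x v : U x ->
  cderive v N x *m N x *m N x + N x *m cderive v N x *m N x +
  N x *m N x *m cderive v N x = 2%:R *: cderive v N x.
Proof.
move=> Ux; rewrite -mulmxDl.
apply: (derive_eq_on Ux _ (mx_is_deriveM (mx_is_deriveM (dN v Ux) (dN v Ux))
  (dN v Ux)) (mx_is_deriveZ 2%:R (dN v Ux))) => y Uy.
by have [] := FN1 Uy.
Qed.

Lemma metric_normal_variation x v : U x -> metric (N x) (cderive v N x) = 0.
Proof.
move=> Ux.
have := derive_eq_onR Ux _ (is_derive_metric (dN v Ux) (dN v Ux))
  (is_derive_cst (1 : R) x v).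
rewrite (metricC (cderive v N x)) => h.
have {}h := h (fun y Uy => let: And4 _ _ e _ := FN1 Uy in e).
by lra.
Qed.

(** Differentiating the orthogonality of N to the derivative of F along v, in the direction u,
    leaves minus the product of N with a second derivative of F, which is symmetric in u and v. *)
Lemma shape_symmetric x u v : U x ->
  metric (cderive u N x) (cderive v F x) = metric (cderive v N x) (cderive u F x).
Proof.
move=> Ux.
have E w w' := derive_eq_onR Ux (fun y => normalN w')
  (is_derive_metric (dN w Ux) (ddF w w' Ux)) (is_derive_cst (0 : R) x w).
have cancel (a b c c' : R) : a + c = 0 -> b + c' = 0 -> c = c' -> a = b.
  by move=> ac bc cc'; apply: (addIr c); rewrite ac [in RHS]cc' bc.
exact: cancel (E u v) (E v u) (congr1 (metric (N x)) (cderive_comm u v oU sF Ux)).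
Qed.

Lemma cderive_row x (w : V) (G : V -> Mat) : csmooth_on U G -> U x ->
  cderive w G x = \sum_k (w 0 k)%:C *: cderive (delta_mx 0 k) G x.
Proof. by move=> sG Ux; rewrite {1}(row_sum_delta w) (cderive_lincomb _ _ sG Ux). Qed.

(** The vector z y solves a linear system with matrix A y, the pairing of the frame at y with the
    frame frozen at x. At x this is a Gram matrix, invertible because the differential of F is
    injective. *)
Lemma coordinates_cvg x u (Z : V -> Mat) Zu (z : V -> V) :
  U x -> injective (fun v => cderive v F x) ->
  mx_is_derive x u Z Zu -> (forall y, U y -> cderive (z y) F y = Z y) ->
  forall i, z (h *: u + x) 0 i @[h --> 0^'] --> z x 0 i.
Proof.
move=> Ux inj dZ zE i.
pose A (y : V) : 'M[R]_d := \matrix_(j, k)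
  metric (cderive (delta_mx 0 j) F y) (cderive (delta_mx 0 k) F x).
have AE y j k : A y j k =
    metric (cderive (delta_mx 0 j) F y) (cderive (delta_mx 0 k) F x).
  by rewrite mxE.
clearbody A.
have mulA y w k : U y ->
    (w *m A y) 0 k = metric (cderive w F y) (cderive (delta_mx 0 k) F x).
  move=> Uy; rewrite (cderive_row w sF Uy) metric_suml mxE.
  by apply: eq_bigr => j _; rewrite AE.
apply: (@linear_system_cvg _ _ _ _ _ (fun h => A (h *: u + x)) (A x)
  (fun h => \row_k metric (Z (h *: u + x)) (cderive (delta_mx 0 k) F x))
  (fun h => z (h *: u + x))).
- move=> j k; rewrite AE.
  have -> : (fun h : R => A (h *: u + x) j k) = fun h => metric
      (cderive (delta_mx 0 j) F (h *: u + x)) (cderive (delta_mx 0 k) F x).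
    by apply/funext => h; exact: AE.
  exact: is_derive_cvg_metric (ddF u (delta_mx 0 j) Ux).
- rewrite -row_free_unit; apply: inj_row_free => w wA.
  apply: inj => /=; rewrite (cderive_row 0 sF Ux).
  rewrite big1 => [|k _]; last by rewrite mxE scale0r.
  apply: metric_self_eq0; first exact: variation_adj.
  rewrite [X in metric X _](cderive_row w sF Ux) metric_suml.
  by apply: big1 => k _; rewrite metricC -mulA// wA mxE mulr0.
- move=> k; rewrite (mulA x _ k Ux) (zE x Ux).
  have -> : (fun h : R => (\row_k metric (Z (h *: u + x))
      (cderive (delta_mx 0 k) F x)) 0 k) = fun h => metric (Z (h *: u + x))
      (cderive (delta_mx 0 k) F x) by apply/funext => h; rewrite mxE.
  exact: is_derive_cvg_metric dZ.
- have cx : (h *: u + x) @[h --> (0 : R)^'] --> x.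
    rewrite -[X in _ --> X]add0r -[X in _ --> X + _](scale0r u).
    apply: cvgD; last exact: cvg_cst.
    have H : h *: u @[h --> (0 : R)] --> (0 : R) *: u by exact: scalel_continuous.
    exact: cvg_within_filter.
  have Uh0 : \forall h \near (0 : R)^', U (h *: u + x).
    exact: cx _ (open_nbhs_nbhs (conj oU Ux)).
  by apply: filterS Uh0 => h Uh; apply/rowP => k; rewrite mulA// zE// mxE.
Qed.

Lemma of_hom_to_hom P (X : Mat) : grass2 P -> tangentG P X ->
  of_hom (to_hom P X) = X.
Proof. by move=> gP [phi phiE <-]; rewrite of_homK. Qed.

Lemma tangent_dist_surj x K : U x -> exists w,
  cderive w F x = of_hom (tgt_compl (F x) (N x) *m K *m F x).
Proof.
move=> Ux; apply: tangent_surj => //; first exact: tangent_dist (FN1 Ux) K.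
exact: metric_normal_dist (FN1 Ux) K.
Qed.

(** A is symmetric and preserves D, so it preserves D^perp as well. *)
Lemma shape_dist_dperp x z Q K : U x -> su2 (F x) Q ->
  cderive z F x = qstr (F x) Q (N x) ->
  metric (cderive z N x) (of_hom (tgt_compl (F x) (N x) *m K *m F x)) = 0.
Proof.
move=> Ux sQ zE; have [w wE] := tangent_dist_surj K Ux.
rewrite -wE shape_symmetric// zE; apply: dist_invariant => // Q' _.
by rewrite wE; exact: metric_dist_qstr (FN1 Ux) K Q'.
Qed.

(** Since N P N is twice the projection onto the line of w, this is twice the D^perp component of
    the derivative of F along v, as a map of V into V^perp. Written as a product, it is
    differentiated by the product rule. *)
Definition block_form v y : Mat :=
  N y *m F y *m N y *m cderive v F y *m F y.

(** By symmetry of A the directions v and z may be exchanged; the derivative of N along z is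
    orthogonal to D, so only the D^perp component of the other factor counts. The factor 1/2 undoes
    the 2 in [block_form]. *)
Lemma shape_dperp_block x z v Q : U x -> su2 (F x) Q ->
  cderive z F x = qstr (F x) Q (N x) ->
  metric (cderive v N x) (qstr (F x) Q (N x)) =
  2^-1 * metric (cderive z N x) (of_hom (block_form v x)).
Proof.
move=> Ux sQ zE.
apply: etrans (etrans (congr1 (metric _) (esym zE)) (shape_symmetric v z Ux)) _.
rewrite /block_form.
have := shape_dist_dperp (cderive v F x) Ux sQ zE.
move: (variation_tangent v Ux); move: (cderive v F x) (cderive z N x) => X W tX WX.
have -> : metric W X = metric W (of_hom (to_hom (F x) X)).
  by rewrite (of_hom_to_hom (gF Ux) tX).
have -> : to_hom (F x) X =
    tgt (F x) (N x) *m X *m F x + tgt_compl (F x) (N x) *m X *m F x.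
  by rewrite -!mulmxDl tgt_add.
have WD (K L : Mat) : metric W (of_hom L) = 0 ->
    metric W (of_hom (K + L)) = metric W (of_hom K).
  by move=> WL; rewrite of_homD metricDr WL addr0.
have WZ (k : R) K : k * metric W (of_hom K) = metric W (of_hom (k%:C *: K)).
  by rewrite of_homZ metricZr.
apply: etrans (WD _ _ WX) (etrans _ (esym (WZ _ _))); apply: congr1; apply: congr1.
have -> : (2^-1)%:C = 2%:R^-1 :> R[i] by rewrite fmorphV rmorph_nat.
by rewrite tgt_mul -scalemxAl !mulmxA.
Qed.

(** The identity of [shape_dperp_block], differentiated along u. Its right-hand side is a sum of
    products of coordinates of z with functions g k vanishing at x, so only the g k get
    differentiated. *)
Lemma is_derive_shape_dperp x u v z0 (Z : V -> Mat) Zu Xu :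
  U x -> injective (fun v => cderive v F x) ->
  (forall y, U y -> exists2 Q, su2 (F y) Q & Z y = qstr (F y) Q (N y)) ->
  mx_is_derive x u Z Zu -> mx_is_derive x u (block_form v) Xu ->
  block_form v x = 0 -> cderive z0 F x = Z x ->
  metric (cderive u (cderive v N) x) (Z x) + metric (cderive v N x) Zu =
  2^-1 * metric (cderive z0 N x) (of_hom Xu).
Proof.
move=> Ux inj ZD dZ dX X0 z0E.
(* Coordinates of Z by pointwise choice, with 0 as a default outside U; their continuity along the
   line comes from [coordinates_cvg]. *)
have [z zE] : exists z : V -> V, forall y, U y -> cderive (z y) F y = Z y.
  suff /choice[z zE] : forall y, exists w, U y -> cderive w F y = Z y by exists z.
  move=> y; have [Uy|nUy] := pselect (U y); last by exists 0.
  have [Q sQ ->] := ZD y Uy.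
  have [w wE] := tangent_surj Uy (tangent_qstr (FN1 Uy) sQ)
    (metric_normal_qstr (FN1 Uy) sQ).
  by exists w.
have zx : z x = z0 by apply: inj => /=; rewrite zE.
pose g k y := 2^-1 * metric (cderive (delta_mx 0 k) N y) (of_hom (block_form v y)).
have gE y : U y -> metric (cderive v N y) (Z y) = \sum_k z y 0 k * g k y.
  move=> Uy; have [Q sQ ZE] := ZD y Uy.
  have wE : cderive (z y) F y = qstr (F y) Q (N y) by rewrite zE.
  rewrite ZE (shape_dperp_block v Uy sQ wE) (cderive_row (z y) sN Uy) metric_suml.
  by rewrite mulr_sumr; apply: eq_bigr => k _; rewrite mulrCA.
have gx k : g k x = 0.
  by rewrite /g X0 of_hom0 metric0r mulr0.
have dg k : is_derive x u (g k)
    (2^-1 * metric (cderive (delta_mx 0 k) N x) (of_hom Xu)).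
  have := is_derive_metric (ddN u (delta_mx 0 k) Ux) (mx_is_derive_of_hom dX).
  move=> dh; apply: is_derive_eq (is_deriveZ (2^-1 : R) dh) _.
  have a0 : metric (cderive u (cderive (delta_mx 0 k) N) x)
      (of_hom (block_form v x)) = 0.
    apply: etrans (congr1 (fun Y => metric _ (of_hom Y)) X0) _.
    by rewrite of_hom0 metric0r.
  by apply: congr1; apply: etrans (congr1 (fun a => a + _) a0) (add0r _).
have cz := coordinates_cvg Ux inj dZ zE.
have dsum := is_derive_sumr (fun k =>
  is_deriveM_vanishing (f := fun y => z y 0 k) (cz k) (gx k) (dg k)).
rewrite (derive_eq_onR Ux gE (is_derive_metric (ddN u v Ux) dZ) dsum).
rewrite (cderive_row z0 sN Ux) metric_suml mulr_sumr zx.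
by apply: eq_bigr => k _; rewrite mulrCA.
Qed.

Lemma is_derive_block_form x u v : U x -> mx_is_derive x u (block_form v)
  ((((cderive u N x *m F x + N x *m cderive u F x) *m N x +
     N x *m F x *m cderive u N x) *m cderive v F x +
    N x *m F x *m N x *m cderive u (cderive v F) x) *m F x +
   N x *m F x *m N x *m cderive v F x *m cderive u F x).
Proof.
move=> Ux; have dNx := dN u Ux; have dFx := dF u Ux; have ddFx := ddF u v Ux.
exact: (mx_is_deriveM (mx_is_deriveM (mx_is_deriveM (mx_is_deriveM dNx dFx) dNx)
  ddFx) dFx).
Qed.

(* The Codazzi equation for the directions u and v, tested against a field Z
   with values in D^perp, in the case where the shape operator vanishes on the
   first direction. *)
Lemma codazzi_dperp x u v z0 (Z : V -> Mat) Zu Zv :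
  U x -> injective (fun v => cderive v F x) ->
  (forall y, U y -> exists2 Q, su2 (F y) Q & Z y = qstr (F y) Q (N y)) ->
  mx_is_derive x u Z Zu -> mx_is_derive x v Z Zv -> cderive z0 F x = Z x ->
  cderive u N x = 0 -> N x *m cderive u F x = 0 ->
  cderive u F x *m N x = 0 -> N x *m F x *m N x *m cderive v F x = 0 ->
  metric (cderive v N x) Zu = - 2^-1 * metric (cderive z0 N x)
    (of_hom (N x *m F x *m cderive v N x *m cderive u F x *m F x)).
Proof.
move=> Ux inj ZD dZu dZv z0E Wu NX XN BY.
have Bv : block_form v x = 0 by rewrite /block_form BY mul0mx.
have Bu : block_form u x = 0 by rewrite /block_form -(mulmxA _ (N x)) NX mulmx0 mul0mx.
have E1 := is_derive_shape_dperp Ux inj ZD dZu (is_derive_block_form u v Ux) Bv z0E.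
have E2 := is_derive_shape_dperp Ux inj ZD dZv (is_derive_block_form v u Ux) Bu z0E.
exact: codazzi_combine (cderive_comm u v oU sN Ux) (cderive_comm u v oU sF Ux)
  Wu NX BY E1 E2.
Qed.

(** By symmetry of A, the derivative of N along u pairs with any tangent vector through the block c
    W e of a derivative W of N, and this vanishes by the cubic relation. As X N = N X = 0 for X = dF
    along u, there is no part normal to the Grassmannian either: all of dN vanishes along u, not
    only its tangential part. *)
Lemma shape_compl_eq0 x u K : U x ->
  cderive u F x = of_hom (tgt_compl (F x) (N x) *m K *m src_compl (F x) (N x)) ->
  [/\ cderive u N x = 0, N x *m cderive u F x = 0 & cderive u F x *m N x = 0].
Proof.
move=> Ux uE; have FN := FN1 Ux.
have XN : cderive u F x *m N x = 0.
  rewrite uE (compl_block_mulN FN) //.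
have NX : N x *m cderive u F x = 0.
  have [NE _] := (tangentGE _ (gF Ux)).1 (tN Ux).
  by rewrite -[LHS]adjmxK adjmxM NE variation_adj// XN trmx0 map_mx0.
split=> //; apply: (normal_variation_eq0 FN XN NX).
- exact: normal_adj.
- exact: normal_variation.
- exact: metric_normal_variation.
move=> T tT NT; have [w <-] := tangent_surj Ux tT NT.
rewrite shape_symmetric// uE metric_of_hom; last exact: normal_adj.
have eWc := variation_block_eq0 FN (normal_cubic_variation w Ux).
have cWe : src_compl (F x) (N x) *m cderive w N x *m tgt_compl (F x) (N x) = 0.
  have /(congr1 (fun Z => Z ^t* )) := eWc.
  rewrite /= !adjmxM (tgt_compl_adj FN) (compl_adj FN) (normal_adj w Ux).
  by rewrite trmx0 map_mx0 mulmxA.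
by rewrite !mulmxA mxtrace_mulC !mulmxA cWe mul0mx mxtrace0 mul0r.
Qed.

Hypothesis reebD : forall y, U y ->
  exists2 Q, su2 (F y) Q & qstr (F y) Q (N y) = - Jstr (F y) (N y).

Lemma shape_dist_block x v L : U x ->
  cderive v F x = of_hom (tgt_compl (F x) (N x) *m L *m F x) ->
  F x *m cderive v N x *m N x *m F x = 0 /\
  forall Q, su2 (F x) Q -> metric (cderive v N x) (qstr (F x) Q (N x)) = 0.
Proof.
move=> Ux vE; have WQ : forall Q, su2 (F x) Q ->
    metric (cderive v N x) (qstr (F x) Q (N x)) = 0.
  apply: dist_invariant => // Q _; rewrite vE.
  exact: metric_dist_qstr (FN1 Ux) L Q.
split=> //; apply: (variation_normal_block_eq0 (FN1 Ux)) => //.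
- exact: normal_adj.
- exact: metric_normal_variation.
have [Q sQ QE] := reebD Ux.
by rewrite -[Jstr _ _]opprK metricNr -QE WQ// oppr0.
Qed.

(* The two uses of the Codazzi equation: against a section of D^perp which is
   orthogonal to xi at x, it shows that A does not vanish on D; against xi, it
   then shows that A xi has no component in D^perp orthogonal to xi. *)
Lemma codazzi_compl x u v K L B z0 :
  U x -> injective (fun v => cderive v F x) ->
  cderive u F x = of_hom (tgt_compl (F x) (N x) *m K *m src_compl (F x) (N x)) ->
  cderive v F x = of_hom (tgt_compl (F x) (N x) *m L *m src (F x) (N x)) ->
  cderive z0 F x =
    of_hom (N x *m F x *m B *m src_compl (F x) (N x)) ->
  complex.Re (\tr (B *m cderive u F x *m cderive v F x *m F x)) =
  - 2^-1 * metric (cderive z0 N x)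
    (of_hom (N x *m F x *m cderive v N x *m cderive u F x *m F x)).
Proof.
move=> Ux inj uE vE zE; have FN := FN1 Ux.
have [Wu NX XN] := shape_compl_eq0 Ux uE.
have vE' : cderive v F x =
    of_hom (tgt_compl (F x) (N x) *m (L *m src (F x) (N x)) *m F x).
  by rewrite vE; congr of_hom; rewrite -!mulmxA (src_mulP FN).
have [PWNP _] := shape_dist_block Ux vE'.
(* The last factor is [src_compl] written out for the product rule. Along u it is the only factor
   varying to first order at x, so the derivative of Z is [of_hom (N P B X)]. *)
pose Z y := of_hom (N y *m F y *m B *m (F y - 2%:R^-1 *: (F y *m N y *m N y))).
have ZE y : Z y = of_hom (N y *m F y *m B *m src_compl (F y) (N y)).
  by rewrite /Z src_complE srcE.
have dZ w := mx_is_derive_of_hom (mx_is_deriveM (mx_is_derive_mulmxr B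
  (mx_is_deriveM (dN w Ux) (dF w Ux))) (mx_is_deriveB (dF w Ux)
    (mx_is_deriveZ 2%:R^-1 (mx_is_deriveM (mx_is_deriveM (dF w Ux) (dN w Ux))
      (dN w Ux))))).
have BY := block_dist_eq0 FN vE.
rewrite -(codazzi_dperp Ux inj _ (dZ u) (dZ v) _ Wu NX XN BY).
- rewrite Wu NX XN !(mul0mx, mulmx0, add0r, addr0, scaler0, subr0).
  have YP := dist_src_block FN vE.
  have [NE _] := (tangentGE _ (gF Ux)).1 (tN Ux).
  rewrite (metric_variation_of_hom FN B (normal_adj v Ux) XN YP PWNP)//.
  exact: normal_variation.
- move=> y Uy; exists (src (F y) (N y) *m B *m src_compl (F y) (N y) -
    src_compl (F y) (N y) *m B ^t* *m src (F y) (N y)).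
    exact: su2_src_compl (FN1 Uy) B.
  by rewrite (qstr_src_compl (FN1 Uy)); exact: ZE.
- by rewrite zE; exact: esym (ZE x).
Qed.

Lemma codazzi_reeb x u v K L z0 :
  U x -> injective (fun v => cderive v F x) ->
  cderive u F x = of_hom (tgt_compl (F x) (N x) *m K *m src_compl (F x) (N x)) ->
  cderive v F x = of_hom (tgt_compl (F x) (N x) *m L *m src (F x) (N x)) ->
  cderive z0 F x = - Jstr (F x) (N x) ->
  metric (cderive z0 N x)
    (of_hom (N x *m F x *m cderive v N x *m cderive u F x *m F x)) = 0.
Proof.
move=> Ux inj uE vE zE; have FN := FN1 Ux.
have [Wu NX XN] := shape_compl_eq0 Ux uE.
pose Z y := - of_hom ('i *: (N y *m F y)).
have dZ w := mx_is_deriveN (mx_is_derive_of_hom (mx_is_deriveZ 'i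
  (mx_is_deriveM (dN w Ux) (dF w Ux)))).
have BY := block_dist_eq0 FN vE.
have ZD y : U y -> exists2 Q, su2 (F y) Q & Z y = qstr (F y) Q (N y).
  move=> Uy; have [Q sQ QE] := reebD Uy; exists Q; first exact: sQ.
  exact: etrans (congr1 -%R (esym (JstrE (FN1 Uy)))) (esym QE).
have zE' : cderive z0 F x = Z x := etrans zE (congr1 -%R (JstrE FN)).
(* The field xi is constant to first order along u, so no curvature term appears. *)
have Z0 : - of_hom ('i *: (cderive u N x *m F x + N x *m cderive u F x)) = 0 :> Mat.
  by rewrite Wu NX mul0mx addr0 scaler0 of_hom0 oppr0.
have half (a b : R) : a = - 2^-1 * b -> a = 0 -> b = 0 by move=> ab a0; lra.
apply: half (codazzi_dperp Ux inj ZD (dZ u) (dZ v) zE' Wu NX XN BY) _.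
by apply: etrans (congr1 (metric _) Z0) (metric0r _).
Qed.

Lemma local_hopf x z : (3 < n)%N -> U x ->
  injective (fun v => cderive v F x) -> cderive z F x = - Jstr (F x) (N x) ->
  exists nu : R, tproj (F x) (cderive z N x) = nu%:C *: Jstr (F x) (N x).
Proof.
move=> n3 Ux inj zE; have FN := FN1 Ux.
have [Q sQ QE] := reebD Ux.
have [K [L /= XYP]] := exists_dist_variations FN n3.
have compl_surj K' : exists u, cderive u F x =
    of_hom (tgt_compl (F x) (N x) *m K' *m src_compl (F x) (N x)).
  have [u uE] := tangent_dist_surj (K' *m src_compl (F x) (N x)) Ux.
  by exists u; rewrite uE; congr of_hom; rewrite -!mulmxA (compl_mulP FN).
have [u0 u0E] := compl_surj K.
have [v vE] : exists v, cderive v F x =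
    of_hom (tgt_compl (F x) (N x) *m L *m src (F x) (N x)).
  have [v vE] := tangent_dist_surj (L *m src (F x) (N x)) Ux.
  by exists v; rewrite vE; congr of_hom; rewrite -!mulmxA (src_mulP FN).
(* If this product vanished, so would the right-hand side of [codazzi_compl] for every B, and
   nondegeneracy of the trace would give X Y P = 0. *)
have PWX : F x *m cderive v N x *m
    of_hom (tgt_compl (F x) (N x) *m K *m src_compl (F x) (N x)) *m F x != 0.
  apply: contra_neq XYP => PWX; apply: Re_mxtrace_nondegenerate => B.
  have sB := su2_src_compl FN B.
  have [z0 z0E] := tangent_surj Ux (tangent_qstr FN sB) (metric_normal_qstr FN sB).
  rewrite (qstr_src_compl FN) in z0E.
  have assoc (A1 A2 A3 A4 A5 : Mat) :
      A1 *m A2 *m A3 *m A4 *m A5 = A1 *m (A2 *m A3 *m A4 *m A5).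
    by rewrite !mulmxA.
  have := codazzi_compl Ux inj u0E vE z0E.
  rewrite u0E vE assoc PWX mulmx0 of_hom0 metric0r mulr0 => <-.
  by rewrite mxtrace_mulC !mulmxA.
apply: (reeb_direction FN); first exact: normal_adj.
- exact: metric_normal_variation.
- by move=> K'; apply: (shape_dist_dperp K' Ux sQ); rewrite QE.
have eWc := variation_block_eq0 FN (normal_cubic_variation v Ux).
apply: (compl_reeb_eq0 FN eWc (normal_adj v Ux) PWX (normal_adj z Ux)) => K'.
have [u uE] := compl_surj K'; rewrite -uE; exact: codazzi_reeb Ux inj uE vE zE.
Qed.

End LocalHypersurface.

(** * From the chart back to the hypersurface *)

Section Hypersurface.
Variables (R : realType) (m : nat).
Local Notation Mat := 'M[R[i]]_(m + 2).
Variables (M : smooth_manifold R (4 * m).-1) (f N : M -> Mat).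
Hypotheses (m_gt0 : (0 < m)%N) (hf : immersion_in_grass2 f).
Hypothesis hN : unit_normal_field f N.
Hypothesis hD : forall p : M, shape_operator f N p @` Ddist f N p `<=` Ddist f N p.
Hypothesis hxi : forall p : M, Dperp f N p (reeb f N p).

Let gP q : grass2 (f q). Proof. by case: hf. Qed.
Let tN q : tangentG (f q) (N q). Proof. by case: hN. Qed.
Let sf : smooth_mx f. Proof. by case: hf. Qed.
Let sN : smooth_mx N. Proof. by case: hN. Qed.

Lemma hypersurface_rank1 q : rank1_normal (f q) (N q).
Proof.
have [_ _ NN _] := hN; have [Q sQ QE] := hxi q.
split; [exact: gP|exact: tN|exact: NN|].
exact: rank_one_of_eigen (gP q) (tN q) (NN q) sQ QE.
Qed.

Let oU p : open (cimage (chart_at (p : M))). Proof. exact: cimage_open. Qed.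
Let sfc p := smooth_mx_csmooth_on p sf.
Let sNc p := smooth_mx_csmooth_on p sN.

Let memU q : cimage (chart_at (q : M)) (cmap (chart_at q) q).
Proof. by exists q => //; exact: mem_chart_at. Qed.

Let rank1_chart p x (Ux : cimage (chart_at (p : M)) x) :
  rank1_normal ((f \o cinv (chart_at p)) x) ((N \o cinv (chart_at p)) x).
Proof. exact: hypersurface_rank1. Qed.

Let cinvK q : cinv (chart_at (q : M)) (cmap (chart_at q) q) = q.
Proof. by apply: cmapK; exact: mem_chart_at. Qed.

Lemma dmx_tangent q v : tangentG (f q) (dmx f q v).
Proof.
have := variation_tangent (@oU q) (sfc q) (@rank1_chart q) v (memU q).
by rewrite /= cinvK.
Qed.

Lemma dmx_normal_adj q v : (dmx N q v) ^t* = dmx N q v.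
Proof.
have := normal_adj (@oU q) (sNc q) (@rank1_chart q) v (memU q).
by rewrite -dmxE.
Qed.

Lemma metric_normal_dmx q v : metric (N q) (dmx f q v) = 0.
Proof. by have [_ _ _ NX] := hN; apply: NX; exists v. Qed.

Lemma dmx_linear q a v w : dmx f q (a *: v + w) = a%:C *: dmx f q v + dmx f q w.
Proof.
have := cderive_lincomb (fun b : bool => if b then a else 1)
  (fun b : bool => if b then v else w) (sfc q) (memU q).
by rewrite !big_bool /= !scale1r.
Qed.

Lemma dmx_inj q : injective (dmx f q).
Proof. by case: hf. Qed.

Lemma dmx_surj q X : tangentG (f q) X -> metric (N q) X = 0 ->
  exists v, dmx f q v = X.
Proof.
have [_ _ NN _] := hN.
apply: hypersurface_tangent_surj (gP q) (tN q) (NN q) (@dmx_linear q)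
  (@dmx_inj q) _ X => [|v]; first by rewrite prednK// muln_gt0.
by split; [exact: dmx_tangent|exact: metric_normal_dmx].
Qed.

Lemma shape_operatorE q v :
  shape_operator f N q (dmx f q v) = - tproj (f q) (dmx N q v).
Proof.
rewrite /shape_operator; congr (- tproj _ (dmx _ _ _)).
by case: xgetP => [w _ /dmx_inj//|/(_ v)]; case.
Qed.

(** The tangential part of dN is - A, and the remaining part is orthogonal to D^perp. The invariance
    of D can therefore be stated on dN itself, without [tproj]. *)
Lemma dist_invariant_dmx q v :
  (forall Q, su2 (f q) Q -> metric (dmx f q v) (qstr (f q) Q (N q)) = 0) ->
  forall Q, su2 (f q) Q -> metric (dmx N q v) (qstr (f q) Q (N q)) = 0.
Proof.
move=> vD Q sQ.
have /hD[_ /(_ (qstr (f q) Q (N q)))] :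
    (shape_operator f N q @` Ddist f N q) (shape_operator f N q (dmx f q v)).
  exists (dmx f q v) => //; split; first by exists v.
  by move=> _ [Q' sQ' <-]; exact: vD.
rewrite shape_operatorE => h.
have {h} : metric (- tproj (f q) (dmx N q v)) (qstr (f q) Q (N q)) = 0.
  by apply: h; exists Q.
have tQ := tangent_qstr (hypersurface_rank1 q) sQ.
have := tproj_orthogonal (gP q) (dmx_normal_adj q v) tQ.
rewrite metricBr (metricC (- _)) metricNr (metricC (dmx N q v)).
by move: (metric _ _) (metric _ _) => a b ab b0; lra.
Qed.

Lemma hypersurface_hopf_at p : (1 < m)%N -> exists nu : R,
  shape_operator f N p (reeb f N p) = nu%:C *: reeb f N p.
Proof.
move=> m1; pose c := chart_at p; pose U := cimage c.
have UE x : U x -> exists2 q, cdom c q & cmap c q = x /\ cinv c x = q.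
  by move=> [q cq <-]; exists q => //; split=> //; exact: cmapK.
have Dperp_reeb q : exists2 Q, su2 (f q) Q & qstr (f q) Q (N q) = - Jstr (f q) (N q).
  by have [Q sQ QE] := hxi q; exists Q.
have [z zE] : exists z, dmx f p z = reeb f N p.
  have [Q sQ QE] := Dperp_reeb p; rewrite /reeb -QE; apply: dmx_surj.
    exact (tangent_qstr (hypersurface_rank1 p) sQ).
  exact (metric_normal_qstr (hypersurface_rank1 p) sQ).
pose F := f \o cinv c; pose G := N \o cinv c.
have FE x q v : cdom c q -> cmap c q = x -> cderive v F x =
    dmx f q ('D_v (transition c (chart_at q)) (cmap c q)).
  by move=> cq <-; exact (cderive_dmx v sf cq).
have GE x q v : cdom c q -> cmap c q = x -> cderive v G x =
    dmx N q ('D_v (transition c (chart_at q)) (cmap c q)).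
  by move=> cq <-; exact (cderive_dmx v sN cq).
have normalG x v : U x -> metric (G x) (cderive v F x) = 0.
  move=> /UE[q cq [qx xq]]; rewrite (FE x q v cq qx) /G /= xq.
  exact (metric_normal_dmx q _).
have surjF x X : U x -> tangentG (F x) X -> metric (G x) X = 0 ->
    exists v, cderive v F x = X.
  move=> /UE[q cq [qx xq]]; rewrite /F /G /= xq => tX NX.
  have [v <-] := dmx_surj tX NX.
  rewrite (dmx_cderive v sf cq) qx.
  by exists ('D_v (transition (chart_at q) c) (cmap (chart_at q) q)).
have distG x v : U x ->
    (forall Q, su2 (F x) Q -> metric (cderive v F x) (qstr (F x) Q (G x)) = 0) ->
    forall Q, su2 (F x) Q -> metric (cderive v G x) (qstr (F x) Q (G x)) = 0.
  move=> /UE[q cq [qx xq]].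
  rewrite (FE x q v cq qx) (GE x q v cq qx) /F /G /= xq.
  exact (@dist_invariant_dmx q _).
have reebG x : U x ->
    exists2 Q, su2 (F x) Q & qstr (F x) Q (G x) = - Jstr (F x) (G x).
  by move=> /UE[q cq [qx xq]]; rewrite /F /G /= xq; exact (Dperp_reeb q).
have m3 : (3 < m + 2)%N by rewrite addn2.
have zE' : cderive z F (cmap c p) = - Jstr (F (cmap c p)) (G (cmap c p)).
  by rewrite /F /G /= cinvK -dmxE.
have [nu] := local_hopf (@oU p) (sfc p) (sNc p) (@rank1_chart p) normalG surjF
  distG reebG m3 (memU p) (@dmx_inj p) zE'.
rewrite /F /G /= cinvK -dmxE => nuE.
(* The minus sign in A matches the one in xi = - J N, so nu itself is the eigenvalue. *)
exists nu; rewrite -[X in shape_operator _ _ _ X]zE shape_operatorE nuE.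
by rewrite /reeb scalerN.
Qed.

End Hypersurface.

Theorem theorem1p5 (R : realType) (m : nat) (hm : (3 <= m)%N)
  (M : smooth_manifold R (4 * m).-1) (hconn : connected [set: M])
  (horient : orientable M)
  (f N : M -> 'M[R[i]]_(m + 2))
  (hf : immersion_in_grass2 f) (hN : unit_normal_field f N)
  (hD : forall p : M, shape_operator f N p @` Ddist f N p `<=` Ddist f N p)
  (hxi : forall p : M, Dperp f N p (reeb f N p)) :
  Hopf f N.
Proof.
have m1 : (1 < m)%N by exact: leq_trans hm.
have [alpha alphaE] := choice (fun p => hypersurface_hopf_at (ltnW m1) hf hN hD hxi p m1).
by exists alpha.
Qed.
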